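(* Let $p,q$ be odd primes with $p\equiv1\pmod q$, and let $\omega\in\Bbbk$ be a primitive $q$-th root of unity. Let $\chi:\mathscr A_0\to\Bbbk$ be the algebra map determined by $\chi(e_g)=\delta_{g,b}$ and $\chi(x)=\omega$. Put $I=D(\mathscr A_0)\langle\chi x\rangle^+$, and let $\overline{\mathcal R}$ be the image in $D(\mathscr A_0)/I\otimes D(\mathscr A_0)/I$ of the standard universal $\mathcal R$-matrix of $D(\mathscr A_0)$. Then $(D(\mathscr A_0)/I,\overline{\mathcal R})$ is a ribbon factorizable Hopf algebra of dimension $p^2q^3$.
   Context: $\Bbbk$ is an algebraically closed field of characteristic $0$. The Hopf algebra $\mathscr A_0$: fix $t\in\mathbb N$ with $t^q\equiv1\pmod p$, $t\not\equiv1\pmod p$. Let $G=\langle a,b\mid a^p=b^q=1,\ bab^{-1}=a^t\rangle$ and $F=\langle x\mid x^q=1\rangle$, with $F$ acting on $G$ on the right by automorphisms: $a\triangleleft x^i=a^{t^i}$, $b\triangleleft x^i=b$. As a vector space $\mathscr A_0=\Bbbk^G\otimes\Bbbk F$ with basis $e_g\#f$ ($g\in G,f\in F$, $e_g$ the delta functions), product $(e_g\#f)(e_{g'}\#f')=\delta_{g\triangleleft f,g'}\,e_g\#ff'$, coproduct $\Delta(e_g\#f)=\sum_{g'g''=g}(e_{g'}\#f)\otimes(e_{g''}\#f)$, unit $\sum_ge_g\#1$, counit $\epsilon(e_g\#f)=\delta_{g,1}$, antipode $S(e_g\#f)=e_{(g\triangleleft f)^{-1}}\#f^{-1}$. Write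 $e_g=e_g\#1$ and $x=\sum_ge_g\#x$. Drinfel'd double: as a coalgebra $D(H)=(H^* )^{cop}\otimes H$, with $(f\otimes h)(g\otimes k)=f[h_{(1)}\rightharpoonup g\leftharpoonup S^{-1}(h_{(3)})]\otimes h_{(2)}k$, where $\langle a\rightharpoonup g\leftharpoonup b,c\rangle=\langle g,bca\rangle$; write $fh$ for $f\otimes h$. Standard $\mathcal R=\sum_ih_i\otimes h^i$ with $\{h_i\},\{h^i\}$ dual bases of $H,H^*$. $\langle\chi x\rangle^+$ is the kernel of the counit on the group algebra of the (central) cyclic group generated by the group-like element $\chi x\in D(\mathscr A_0)$. A quasitriangular Hopf algebra $(K,R)$ is factorizable if $K^*\to K$, $a\mapsto(a\otimes\mathrm{Id})(R_{21}R)$ is bijective; it is ribbon if, with $R=\sum_iR_i\otimes R^i$ and $u=\sum_iS(R^i)R_i$, there is a central $v$ with $v^2=uS(u)$, $S(v)=v$, $\epsilon(v)=1$, $\Delta(v)=(v\otimes v)(R_{21}R)^{-1}$. *)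

(* Defs.v *)
From mathcomp Require Import all_boot all_order all_fingroup all_algebra.

Set Implicit Arguments.
Unset Strict Implicit.
Unset Printing Implicit Defensive.

Import GRing.Theory VectorInternalTheory.
Local Open Scope ring_scope.

(* Tensor products of finite-dimensional spaces, realised as matrices of      *)
(* coordinates in the canonical bases bvec of the two factors.                *)

Definition tensor (k : fieldType) (V W : vectType k) : vectType k :=
  'M[k]_(dim V, dim W).

Section Tensor.
Context {k : fieldType}.
Implicit Types U V W X : vectType k.

Definition bvec V (i : 'I_(dim V)) : V := r2v (delta_mx 0 i).

Definition dvec V (i : 'I_(dim V)) : 'Hom(V, k^o) :=
  linfun (fun v : V => v2r v 0 i : k^o).

Definition tens V W (v : V) (w : W) : tensor V W := (v2r v)^T *m v2r w.

(* The linear map with v (x) w |-> phi v w; meaningful for bilinear phi only. *)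
Definition tlift V W U (phi : V -> W -> U) : 'Hom(tensor V W, U) :=
  linfun (fun z : tensor V W =>
    \sum_i \sum_j (z : 'M_(_, _)) i j *: phi (bvec i) (bvec j)).

Definition tmap V W V' W' (f : 'Hom(V, V')) (g : 'Hom(W, W')) :
    'Hom(tensor V W, tensor V' W') :=
  tlift (fun v w => tens (f v) (g w)).

Definition tflip V W : 'Hom(tensor V W, tensor W V) :=
  tlift (fun v w => tens w v).

Definition tassoc V W U :
    'Hom(tensor V (tensor W U), tensor (tensor V W) U) :=
  tlift (fun v z => tlift (fun w u => tens (tens v w) u) z).

(* Multiplication (v (x) w)(v' (x) w') = v v' (x) w w'. *)
Definition tmul V W (mV : 'Hom(tensor V V, V)) (mW : 'Hom(tensor W W, W)) :
    'Hom(tensor (tensor V W) (tensor V W), tensor V W) :=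
  tlift (fun x y => tlift (fun v w => tlift (fun v' w' =>
    tens (mV (tens v v')) (mW (tens w w'))) y) x).

End Tensor.

Arguments tflip {k} V W.
Arguments tassoc {k} V W U.

(* The structure maps of a Hopf algebra; the axioms are in is_hopf. *)
Record hopf_ops (k : fieldType) (V : vectType k) := HopfOps {
  hmul : 'Hom(tensor V V, V);
  hone : V;
  hcomul : 'Hom(V, tensor V V);
  hcounit : 'Hom(V, k^o);
  hanti : 'End(V)
}.

Section Hopf.
Context {k : fieldType} {V : vectType k} (H : hopf_ops V).

Definition hprod (x y : V) : V := hmul H (tens x y).
Definition tprod (x y : tensor V V) : tensor V V :=
  tmul (hmul H) (hmul H) (tens x y).
Definition tone : tensor V V := tens (hone H) (hone H).
Definition tprod3 (x y : tensor (tensor V V) V) : tensor (tensor V V) V :=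
  tmul (tmul (hmul H) (hmul H)) (hmul H) (tens x y).
Definition hpow (x : V) (n : nat) : V := iter n (hprod x) (hone H).

Record is_hopf : Prop := IsHopf {
  hopf_mulA : forall x y z, hprod x (hprod y z) = hprod (hprod x y) z;
  hopf_mul1l : forall x, hprod (hone H) x = x;
  hopf_mul1r : forall x, hprod x (hone H) = x;
  hopf_comulA : forall x,
    tassoc V V V (tmap \1%VF (hcomul H) (hcomul H x))
    = tmap (hcomul H) \1%VF (hcomul H x);
  hopf_counitl : forall x,
    tlift (fun a b => (hcounit H a : k) *: b) (hcomul H x) = x;
  hopf_counitr : forall x,
    tlift (fun a b => (hcounit H b : k) *: a) (hcomul H x) = x;
  hopf_comul1 : hcomul H (hone H) = tone;
  hopf_comulM : forall x y,
    hcomul H (hprod x y) = tprod (hcomul H x) (hcomul H y);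
  hopf_counit1 : hcounit H (hone H) = 1;
  hopf_counitM : forall x y,
    hcounit H (hprod x y) = hcounit H x * hcounit H y;
  hopf_antil : forall x,
    tlift (fun a b => hprod (hanti H a) b) (hcomul H x)
    = (hcounit H x : k) *: hone H;
  hopf_antir : forall x,
    tlift (fun a b => hprod a (hanti H b)) (hcomul H x)
    = (hcounit H x : k) *: hone H
}.

Definition is_character (chi : 'Hom(V, k^o)) : Prop :=
  chi (hone H) = 1 /\ forall x y, chi (hprod x y) = chi x * chi y.

Definition dual_hopf : hopf_ops 'Hom(V, k^o) := {|
  hmul := tlift (fun f g : 'Hom(V, k^o) =>
    linfun (tlift (fun a b => f a * g b : k^o) \o hcomul H));
  hone := hcounit H;
  hcomul := linfun (fun f : 'Hom(V, k^o) => \sum_i \sum_j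
    (f (hprod (bvec i) (bvec j)) : k) *: tens (dvec i) (dvec j));
  hcounit := linfun (fun f : 'Hom(V, k^o) => f (hone H));
  hanti := linfun (fun f : 'Hom(V, k^o) => (f \o hanti H)%VF)
|}.

Definition cop_hopf : hopf_ops V := {|
  hmul := hmul H;
  hone := hone H;
  hcomul := (tflip V V \o hcomul H)%VF;
  hcounit := hcounit H;
  hanti := (hanti H)^-1%VF
|}.

(* R = sum_i R_i (x) R^i is an R-matrix: R is invertible,                     *)
(* R Delta(h) = Delta^op(h) R, (Delta (x) id) R = R13 R23 and                 *)
(* (id (x) Delta) R = R13 R12.                                                *)
Definition R12 (R : tensor V V) : tensor (tensor V V) V := tens R (hone H).
Definition R13 (R : tensor V V) : tensor (tensor V V) V :=
  tlift (fun a b => tens (tens a (hone H)) b) R.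
Definition R23 (R : tensor V V) : tensor (tensor V V) V :=
  tlift (fun a b => tens (tens (hone H) a) b) R.

Definition tinverse (x y : tensor V V) : Prop :=
  tprod x y = tone /\ tprod y x = tone.

Record is_quasitriangular (R : tensor V V) : Prop := IsQuasitriangular {
  qt_inv : exists R', tinverse R R';
  qt_comul : forall h,
    tprod R (hcomul H h) = tprod (tflip V V (hcomul H h)) R;
  qt_coml : tmap (hcomul H) \1%VF R = tprod3 (R13 R) (R23 R);
  qt_comr : tassoc V V V (tmap \1%VF (hcomul H) R) = tprod3 (R13 R) (R12 R)
}.

(* R_21 R *)
Definition monodromy (R : tensor V V) : tensor V V := tprod (tflip V V R) R.

Definition is_factorizable (R : tensor V V) : Prop :=
  bijective (fun f : 'Hom(V, k^o) =>
    tlift (fun a b => (f a : k) *: b) (monodromy R)).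

(* u = sum_i S(R^i) R_i *)
Definition drinfeld_elt (R : tensor V V) : V :=
  tlift (fun a b => hprod (hanti H b) a) R.

Definition is_ribbon (R : tensor V V) : Prop :=
  let u := drinfeld_elt R in
  exists v : V,
    [/\ forall x, hprod v x = hprod x v,
        hprod v v = hprod u (hanti H u),
        hanti H v = v,
        hcounit H v = 1 &
        exists2 M', tinverse (monodromy R) M' &
          hcomul H v = tprod (tens v v) M'].

(* The span of the cyclic group generated by a group-like element x. Distinct *)
(* group-likes are linearly independent, so this group has at most dim V      *)
(* elements, all of them of the form x^n with n < dim V.                      *)
Definition cyclic_algebra (x : V) : {vspace V} :=
  <<[seq hpow x n | n <- iota 0 (dim V)]>>%VS.

Definition cyclic_algebra_plus (x : V) : {vspace V} :=
  (cyclic_algebra x :&: lker (hcounit H))%VS.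

Definition left_ideal (B : {vspace V}) : {vspace V} :=
  <<[seq hprod d z | d <- vbasis {: V}%VS, z <- vbasis B]>>%VS.

End Hopf.

Definition hopf_morphism (k : fieldType) (V W : vectType k)
    (H : hopf_ops V) (K : hopf_ops W) (f : 'Hom(V, W)) : Prop :=
  [/\ forall x y, f (hprod H x y) = hprod K (f x) (f y),
      f (hone H) = hone K,
      forall x, hcomul K (f x) = tmap f f (hcomul H x),
      forall x, hcounit K (f x) = hcounit H x &
      forall x, hanti K (f x) = f (hanti H x)].

Section Double.
Context {k : fieldType} {V : vectType k} (H : hopf_ops V).
Let dV : vectType k := 'Hom(V, k^o).
Let Hdcop : hopf_ops dV := cop_hopf (dual_hopf H).

(* <a -> g <- b, c> = <g, b c a> *)
Definition dact (a : V) (g : dV) (b : V) : dV :=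
  linfun (fun c => g (hprod H (hprod H b c) a)).

(* (f (x) h)(g (x) l) = f [h_(1) -> g <- S^-1(h_(3))] (x) h_(2) l *)
Definition double_prod (f : dV) (h : V) (g : dV) (l : V) : tensor dV V :=
  tlift (fun h12 h3 => tlift (fun h1 h2 =>
      tens (hprod Hdcop f (dact h1 g ((hanti H)^-1%VF h3))) (hprod H h2 l)) h12)
    (tmap (hcomul H) \1%VF (hcomul H h)).

Definition double_mul :
    'Hom(tensor (tensor dV V) (tensor dV V), tensor dV V) :=
  tlift (fun x y => tlift (fun f h => tlift (fun g l =>
    double_prod f h g l) y) x).

(* The antipode is S(f (x) h) = (eps (x) S h) (S f (x) 1), the inner S on f   *)
(* being that of (H^* )^cop.                                                  *)
Definition drinfeld_double : hopf_ops (tensor dV V) := {|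
  hmul := double_mul;
  hone := tens (hone Hdcop) (hone H);
  hcomul := tlift (fun f h => tlift (fun f1 f2 => tlift (fun h1 h2 =>
    tens (tens f1 h1) (tens f2 h2)) (hcomul H h)) (hcomul Hdcop f));
  hcounit := tlift (fun f h => hcounit Hdcop f * hcounit H h : k^o);
  hanti := tlift (fun f h => double_mul
    (tens (tens (hone Hdcop) (hanti H h)) (tens (hanti Hdcop f) (hone H))))
|}.

Definition drinfeld_double_R : tensor (tensor dV V) (tensor dV V) :=
  \sum_(i < dim V)
    tens (tens (hone Hdcop) (bvec i)) (tens (dvec i) (hone H)).

End Double.

(* The quotient V / I, realised on the complement I^C: quot_proj is the       *)
(* projection along I, and each operation is computed on representatives.     *)
Notation quot I := (subvs_of (I^C)%VS).

Section Quotient.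
Context {k : fieldType} {V : vectType k} (I : {vspace V}).

Definition quot_proj : 'Hom(V, quot I) :=
  (linfun (vsproj (I^C)) \o daddv_pi (I^C) I)%VF.

Definition quot_repr : 'Hom(quot I, V) := linfun vsval.

Lemma quot_projK : cancel quot_repr quot_proj.
Proof.
move=> w; rewrite comp_lfunE !lfunE /=.
have IC : (I^C :&: I = 0)%VS by rewrite capvC capv_compl.
by rewrite daddv_pi_id ?subvsP //; apply: vsvalK.
Qed.

Lemma limg_quot_proj : limg quot_proj = fullv.
Proof.
apply/vspaceP=> w; rewrite memvf -(quot_projK w).
by apply: memv_img; apply: memvf.
Qed.

Lemma lker_quot_proj : lker quot_proj = I.
Proof.
have IC : (I^C :&: I = 0)%VS by rewrite capvC capv_compl.
have IC' : (I :&: I^C = 0)%VS by rewrite capv_compl.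
apply/vspaceP=> v; rewrite memv_ker comp_lfunE lfunE /=.
have dv : daddv_pi (I^C)%VS I v + daddv_pi I (I^C)%VS v = v.
  by apply: (daddv_pi_add IC); rewrite addvC addv_complf memvf.
apply/eqP/idP => [/(congr1 vsval)|vI].
  by rewrite vsprojK ?memv_pi // => d0; rewrite -dv d0 add0r memv_pi.
have d0 : daddv_pi (I^C)%VS I v = 0.
  by move: dv; rewrite (daddv_pi_id IC' vI) => /(canRL (addrK _)); rewrite subrr.
by rewrite d0 linear0.
Qed.

Definition quot_hopf (H : hopf_ops V) : hopf_ops (quot I) := {|
  hmul := (quot_proj \o hmul H \o tmap quot_repr quot_repr)%VF;
  hone := quot_proj (hone H);
  hcomul := (tmap quot_proj quot_proj \o hcomul H \o quot_repr)%VF;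
  hcounit := (hcounit H \o quot_repr)%VF;
  hanti := (quot_proj \o hanti H \o quot_repr)%VF
|}.

End Quotient.

(* The smash product k^G # kF for a right action of F on G by automorphisms.  *)
Section Smash.
Context {k : fieldType} {gT fT : finGroupType}.

Definition smash : vectType k := {ffun gT * fT -> k^o}.

(* e_g # f *)
Definition ebas (g : gT) (f : fT) : smash := [ffun z => (z == (g, f))%:R].

(* The linear map with e_g # f |-> phi g f. *)
Definition elin (U : vectType k) (phi : gT -> fT -> U) : 'Hom(smash, U) :=
  linfun (fun u : smash => \sum_g \sum_f (u (g, f) : k) *: phi g f).

Definition smash_hopf (act : groupAction [set: fT] [set: gT]) :
    hopf_ops smash := {|
  hmul := tlift (fun u u' : smash =>
    elin (fun g f => elin (fun g' f' =>
      if act g f == g' then ebas g (f * f')%g else 0) u') u);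
  hone := \sum_(g : gT) ebas g 1%g;
  hcomul := elin (fun g f =>
    \sum_(z : gT * gT | (z.1 * z.2)%g == g) tens (ebas z.1 f) (ebas z.2 f));
  hcounit := elin (fun g f => (g == 1%g)%:R : k^o);
  hanti := elin (fun g f => ebas (act g f)^-1%g f^-1%g)
|}.

End Smash.
Arguments smash k gT fT : clear implicits.
Arguments smash_hopf k {gT fT} act.

(* Main.v *)
Require Import Defs.
From HB Require Import structures.
From mathcomp Require Import all_boot all_order all_fingroup all_algebra.
From mathcomp Require Import ring zify cyclic.

Set Implicit Arguments.
Unset Strict Implicit.
Unset Printing Implicit Defensive.

Import GRing.Theory VectorInternalTheory.
Local Open Scope ring_scope.

(** Write [G], [F] for the two groups, [theta : F -> G] for the homomorphism
    x^n |-> b^n and [beta] for the bicharacter (x^i, x^j) |-> omega^(ij) of [F].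
    The action of [F] on [G] is conjugation through [theta], because both agree
    on the generators [a] and [b].  From then on only [F] abelian, [theta] and
    [beta] matter; the primes enter again in the dimension count and in the
    nondegeneracy of the square of [beta], for which [q] has to be odd.

    All the algebras below are bismash products: they have a basis e(o; g)
    indexed by an object [o] of a finite group [S] and an arrow [g] of a finite
    group [A], where [A] acts on the set [S] from the right and [S] acts on the
    set [A] from the left, and
      e(o; g) e(o'; g') = delta_(o', o <| g) e(o; g g'),
      Delta e(o; g) = sum over o1 o2 = o of e(o1; o2 |> g) (x) e(o2; g).
    A bismash product of a matched pair is a Hopf algebra
    ([bismash_is_hopf]).  The proof, like the later ones, computes with sections
    sum_o c(o) e(o; m(o)), one scalar and one arrow for every object: products
    and coproducts of sections are sections, so that each identity becomes an
    identity of scalars and an identity of words in the groups, object by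
    object.

    The Drinfeld double of k^G # kF is a bismash product with objects
    (v, f) in G x F and arrows (h, s) in the direct product G x F
    ([double_bismash]).  The coordinates are chosen so that [s] does not act,
    the central group-like (chi x)^n is
    z_s = sum_(v, f) beta(f, s) e((v, f); (1, s)) with s = x^n, and
    e(o; (h, s)) z_s^-1 is a scalar multiple of e(o; (h, 1)).  Hence the double
    is the tensor product of the group algebra of the powers of chi x with the
    subalgebra where s = 1: sending e((v, f); (h, s)) to
    beta(f, s)^-1 e((v, f); (h, 1)) is an idempotent Hopf endomorphism whose
    kernel is the ideal [I] ([lker_split_proj]), and the quotient is the bismash
    product of G x F with G ([quot_is_bismash]), of dimension |G|^2 |F|.

    In the quotient, R, R_21 R and the Drinfeld element u are explicit sections.
    The axioms of an R-matrix are identities of words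
    ([conjR_quasitriangular]); u is central, fixed by the antipode and satisfies
    Delta u = (u (x) u) (R_21 R)^-1, so that u itself is a ribbon element
    ([conj_ribbon]).  In coordinates the map defined by R_21 R is block
    diagonal, each block being the matrix with entries beta(f, n)^-2; it is
    invertible by orthogonality of characters ([conj_factorizable]). *)

(** * Multilinear maps on tensor products *)

Section TensorCalculus.
Context {k : fieldType}.
Implicit Types U V W : vectType k.

Lemma bvec_sum V (v : V) : v = \sum_i (v2r v) 0 i *: bvec i.
Proof.
apply: (can_inj v2rK); rewrite linear_sum /= [LHS]row_sum_delta.
by apply: eq_bigr => i _; rewrite linearZ /= r2vK.
Qed.

Lemma tens_linl V W (w : W) : linear (fun v : V => tens v w).
Proof. by move=> a u v; rewrite /tens linearP /= linearP /= mulmxDl -scalemxAl. Qed.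

Lemma tens_linr V W (v : V) : linear (fun w : W => tens v w).
Proof. by move=> a u w; rewrite /tens linearP /= mulmxDr -scalemxAr. Qed.

Lemma linear_sumP V U (f : V -> U) (fL : linear f) (I : Type) (r : seq I)
    (P : pred I) (c : I -> k) (F : I -> V) :
  f (\sum_(i <- r | P i) c i *: F i) = \sum_(i <- r | P i) c i *: f (F i).
Proof.
have f0 : f 0 = 0.
  have := fL (-1) 0 0; rewrite !scaler0 addr0 => /eqP.
  by rewrite scaleN1r addNr => /eqP.
elim/big_rec2: _ => // i y x _ <-; exact: fL.
Qed.

Definition bilin V W U (phi : V -> W -> U) :=
  (forall w, linear (phi^~ w)) /\ (forall v, linear (phi v)).

Lemma tens_coord V W (v : V) (w : W) i j :
  (tens v w : 'M_(_, _)) i j = v2r v 0 i * v2r w 0 j.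
Proof. by rewrite /tens mxE big_ord1 !mxE. Qed.

Lemma tens_bvec V W i j :
  tens (bvec i : V) (bvec j : W) = delta_mx i j :> 'M[k]_(_, _).
Proof.
apply/matrixP=> i' j'; rewrite tens_coord /bvec !r2vK !mxE !eqxx /=.
by rewrite -natrM mulnb.
Qed.

(** [tlift phi] is linear in the tensor for every function [phi], so that it can
    be expanded before the bilinearity of [phi] is known. *)
Lemma tliftE0 V W U (phi : V -> W -> U) z :
  tlift phi z = \sum_i \sum_j (z : 'M_(_, _)) i j *: phi (bvec i) (bvec j).
Proof.
rewrite /tlift; set F := (fun z : tensor V W => _).
have FL : linear F.
  move=> a u v; rewrite /F scaler_sumr -big_split; apply: eq_bigr => i _.
  rewrite scaler_sumr -big_split; apply: eq_bigr => j _.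
  by rewrite !mxE scalerDl scalerA.
pose F' : {linear tensor V W -> U} := HB.pack F (GRing.isLinear.Build _ _ _ _ _ FL).
exact: (lfunE F').
Qed.

Lemma tliftE V W U (phi : V -> W -> U) v w :
  bilin phi -> tlift phi (tens v w) = phi v w.
Proof.
move=> [pl pr]; rewrite tliftE0 {2}(bvec_sum v) (linear_sumP (pl w)).
apply: eq_bigr => i _; rewrite {2}(bvec_sum w) (linear_sumP (pr _)) scaler_sumr.
by apply: eq_bigr => j _; rewrite tens_coord scalerA.
Qed.

Lemma linfunE V U (f : V -> U) (fL : linear f) v : linfun f v = f v.
Proof.
pose F' : {linear V -> U} := HB.pack f (GRing.isLinear.Build _ _ _ _ _ fL).
exact: (lfunE F').
Qed.

Lemma tlift_linphi V W U (phi psi : V -> W -> U) a z :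
  tlift (fun v w => a *: phi v w + psi v w) z = a *: tlift phi z + tlift psi z.
Proof.
rewrite !tliftE0 scaler_sumr -big_split; apply: eq_bigr => i _.
rewrite scaler_sumr -big_split; apply: eq_bigr => j _.
by rewrite scalerDr !scalerA mulrC.
Qed.

Lemma tlift_eq V W U (phi psi : V -> W -> U) : phi =2 psi -> tlift phi =1 tlift psi.
Proof.
by move=> E z; rewrite !tliftE0; apply: eq_bigr => i _; apply: eq_bigr => j _; rewrite E.
Qed.

End TensorCalculus.

Section Linearity.
Context {k : fieldType}.
Implicit Types T U V W : vectType k.

(** Closure rules for linearity of functions given by expressions; the tactics
    [lin] and [bil] apply them recursively to discharge the side conditions of
    [tliftE] and of the extensionality principles. *)
Lemma lin_id V : linear (fun v : V => v).
Proof. by []. Qed.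

Lemma lin_lfun V W U (g : 'Hom(W, U)) (f : V -> W) :
  linear f -> linear (fun v => g (f v)).
Proof. by move=> fL a u v; rewrite fL linearP. Qed.

Lemma lin_tensl V W U (f : V -> W) (w : U) :
  linear f -> linear (fun v => tens (f v) w).
Proof. by move=> fL a u v; rewrite fL tens_linl. Qed.

Lemma lin_tensr V W U (f : V -> W) (w : U) :
  linear f -> linear (fun v => tens w (f v)).
Proof. by move=> fL a u v; rewrite fL tens_linr. Qed.

Lemma lin_tlift T V W U (phi : T -> V -> W -> U) z :
  (forall v w, linear (fun t => phi t v w)) ->
  linear (fun t => tlift (phi t) z).
Proof.
move=> phiL a u v; rewrite -tlift_linphi; apply: tlift_eq => x y.
exact: phiL.
Qed.

Lemma lin_linfun T V U (F : T -> V -> U) :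
  (forall t, linear (F t)) -> (forall v, linear (fun t => F t v)) ->
  linear (fun t => linfun (F t)).
Proof.
move=> FL FR a u v; apply/lfunP => x.
by rewrite add_lfunE scale_lfunE !linfunE // FR.
Qed.

Lemma lin_app T V U (f : T -> 'Hom(V, U)) (x : V) :
  linear f -> linear (fun t => f t x).
Proof. by move=> fL a u v; rewrite fL add_lfunE scale_lfunE. Qed.

Lemma lin_scalel V U (f : V -> k^o) (w : U) :
  linear f -> linear (fun v => (f v : k) *: w).
Proof. by move=> fL a u v; rewrite fL scalerDl scalerA. Qed.

Lemma lin_scaler V U (f : V -> U) (c : k) :
  linear f -> linear (fun v => c *: f v).
Proof. by move=> fL a u v; rewrite fL scalerDr !scalerA mulrC. Qed.

Lemma lin_mull V (f : V -> k^o) (c : k^o) :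
  linear f -> linear (fun v => f v * c : k^o).
Proof. by move=> fL a u v; rewrite fL mulrDl scalerAl. Qed.

Lemma lin_mulr V (f : V -> k^o) (c : k^o) :
  linear f -> linear (fun v => c * f v : k^o).
Proof. by move=> fL a u v; rewrite fL mulrDr scalerAr. Qed.

Lemma lin_sum V U (I : Type) (r : seq I) (P : pred I) (f : I -> V -> U) :
  (forall i, linear (f i)) -> linear (fun v => \sum_(i <- r | P i) f i v).
Proof.
move=> fL a u v; rewrite scaler_sumr -big_split.
by apply: eq_bigr => i _; exact: fL.
Qed.

Lemma lin_comp T V U W (f : T -> 'Hom(U, W)) (g : 'Hom(V, U)) :
  linear f -> linear (fun t => (f t \o g)%VF).
Proof.
move=> fL a u v; apply/lfunP=> x.
by rewrite fL add_lfunE scale_lfunE !comp_lfunE add_lfunE scale_lfunE.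
Qed.

Lemma lin_ffun (I : finType) U (V : vectType k) (f : V -> {ffun I -> U}) i :
  linear f -> linear (fun v => f v i).
Proof. by move=> fL a u v; rewrite fL !ffunE. Qed.

End Linearity.


Ltac lin_step :=
  cbv beta;
  first
  [ apply: lin_id
  | apply: lin_tensl
  | apply: lin_tensr
  | apply: lin_mull
  | apply: lin_mulr
  | apply: lin_scalel
  | apply: lin_scaler
  | apply: lin_lfun
  | apply: lin_ffun
  | apply: lin_tlift => ? ?
  | apply: lin_sum => ?
  | apply: lin_linfun => ?
  | apply: lin_comp
  | apply: lin_app ].
Ltac lin := unfold hprod; repeat (intros; lin_step).
Ltac bil := split=> ?; lin.

Section TensorMaps.
Context {k : fieldType}.
Implicit Types T U V W : vectType k.

Lemma tmapE V W V' W' (f : 'Hom(V, V')) (g : 'Hom(W, W')) v w :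
  tmap f g (tens v w) = tens (f v) (g w).
Proof. by rewrite /tmap tliftE //; bil. Qed.

Lemma tflipE V W (v : V) (w : W) : tflip V W (tens v w) = tens w v.
Proof. by rewrite /tflip tliftE //; bil. Qed.

Lemma tassocE V W U (v : V) (w : W) (u : U) :
  tassoc V W U (tens v (tens w u)) = tens (tens v w) u.
Proof. by rewrite /tassoc tliftE; [rewrite tliftE //; bil | bil]. Qed.

Lemma tmulE V W (mV : 'Hom(tensor V V, V)) (mW : 'Hom(tensor W W, W)) v w v' w' :
  tmul mV mW (tens (tens v w) (tens v' w')) = tens (mV (tens v v')) (mW (tens w w')).
Proof.
rewrite /tmul tliftE; last bil.
rewrite tliftE; last bil.
by rewrite tliftE //; bil.
Qed.

Lemma tprodE V (H : hopf_ops V) a b c d :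
  tprod H (tens a b) (tens c d) = tens (hprod H a c) (hprod H b d).
Proof. exact: tmulE. Qed.

Lemma tprod3E V (H : hopf_ops V) a b c a' b' c' :
  tprod3 H (tens (tens a b) c) (tens (tens a' b') c') =
  tens (tens (hprod H a a') (hprod H b b')) (hprod H c c').
Proof. by rewrite /tprod3 !tmulE. Qed.

Lemma tensZl (V W : vectType k) a (v : V) (w : W) :
  tens (a *: v) w = a *: tens v w.
Proof. by have := tens_linl w a v 0; rewrite /tens !(linear0, mul0mx, trmx0) !addr0. Qed.

Lemma tensZr (V W : vectType k) a (v : V) (w : W) :
  tens v (a *: w) = a *: tens v w.
Proof. by have := tens_linr v a w 0; rewrite /tens !(linear0, mulmx0) !addr0. Qed.

Lemma lin_sum1 (V U : vectType k) (f : V -> U) (fL : linear f) (I : Type)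
    (r : seq I) (P : pred I) (F : I -> V) :
  f (\sum_(i <- r | P i) F i) = \sum_(i <- r | P i) f (F i).
Proof.
under [in LHS]eq_bigr => i _ do rewrite -[F i]scale1r.
rewrite (linear_sumP fL _ _ (fun=> 1)).
by apply: eq_bigr => i _; rewrite scale1r.
Qed.

Lemma lfun_sum (X Y : vectType k) (f : 'Hom(X, Y)) (I : Type) (r : seq I)
    (P : pred I) (F : I -> X) :
  f (\sum_(i <- r | P i) F i) = \sum_(i <- r | P i) f (F i).
Proof. exact: lin_sum1 (linearP f) _ _ _ _. Qed.

Lemma hprod_bilin V (H : hopf_ops V) : bilin (hprod H).
Proof. by bil. Qed.

Lemma hprodZl V (H : hopf_ops V) a y z : hprod H (a *: y) z = a *: hprod H y z.
Proof. by rewrite /hprod tensZl linearZ. Qed.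

Lemma hprodZr V (H : hopf_ops V) a y z : hprod H y (a *: z) = a *: hprod H y z.
Proof. by rewrite /hprod tensZr linearZ. Qed.

(** A family is allowed to be linearly dependent here: identities between
    linear maps only have to be tested on a spanning family. *)
Definition spans (I : finType) V (e : I -> V) :=
  forall v, exists c : I -> k, v = \sum_i c i *: e i.

Lemma tensor_sum V W (z : tensor V W) :
  z = \sum_i \sum_j (z : 'M_(_, _)) i j *: tens (bvec i) (bvec j).
Proof.
apply/matrixP=> i' j'; rewrite pair_big /=.
pose coord (y : tensor V W) : k^o := (y : 'M_(_, _)) i' j'.
have coordL : linear coord by move=> a u v; rewrite /coord !mxE.
rewrite -[RHS]/(coord _) (linear_sumP coordL) (bigD1 (i', j')) //= big1.
  by rewrite addr0 /coord tens_bvec mxE !eqxx /= -[LHS]mulr1.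
move=> [i j] /= neq; rewrite /coord tens_bvec mxE.
rewrite [i' == i]eq_sym [j' == j]eq_sym -xpair_eqE (negPf neq).
exact: mulr0.
Qed.

Lemma spans_tens (I J : finType) V W (e : I -> V) (f : J -> W) :
  spans e -> spans f -> spans (fun ij : I * J => tens (e ij.1) (f ij.2)).
Proof.
move=> eS fS z.
have [c cE] := fin_all_exists (fun i : 'I_(dim V) => eS (bvec i)).
have [d dE] := fin_all_exists (fun j : 'I_(dim W) => fS (bvec j)).
exists (fun ij => \sum_i \sum_j (z : 'M_(_, _)) i j * (c i ij.1 * d j ij.2)).
rewrite {1}[z]tensor_sum.
under [RHS]eq_bigr => p _ do rewrite scaler_suml.
rewrite [RHS]exchange_big; apply: eq_bigr => i _.
under [RHS]eq_bigr => p _ do rewrite scaler_suml.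
rewrite [RHS]exchange_big; apply: eq_bigr => j _.
under [RHS]eq_bigr => p _ do rewrite -scalerA.
rewrite -scaler_sumr; congr (_ *: _).
rewrite {1}cE {1}dE (linear_sumP (tens_linl _)).
under eq_bigr => i1 _ do rewrite (linear_sumP (tens_linr _)) scaler_sumr.
by rewrite pair_big; apply: eq_bigr => p _; rewrite scalerA.
Qed.

Lemma spans_eq (I : finType) V U (e : I -> V) (f g : V -> U) :
  spans e -> linear f -> linear g -> (forall i, f (e i) = g (e i)) -> f =1 g.
Proof.
move=> eS fL gL fg v; have [c ->] := eS v.
by rewrite !linear_sumP //; apply: eq_bigr => i _; rewrite fg.
Qed.

Lemma tensor_eq V W U (f g : 'Hom(tensor V W, U)) :
  (forall v w, f (tens v w) = g (tens v w)) -> f =1 g.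
Proof.
move=> fg z; rewrite [z]tensor_sum !linear_sum; apply: eq_bigr => i _.
by rewrite !linear_sum; apply: eq_bigr => j _; rewrite !linearZ /= fg.
Qed.

Lemma tmap_comp (V W V' W' V'' W'' : vectType k) (f : 'Hom(V', V''))
    (g : 'Hom(W', W'')) (f' : 'Hom(V, V')) (g' : 'Hom(W, W')) z :
  tmap f g (tmap f' g' z) = tmap (f \o f')%VF (g \o g')%VF z.
Proof.
rewrite -comp_lfunE; move: z; apply: tensor_eq => v w.
by rewrite comp_lfunE !tmapE !comp_lfunE.
Qed.

Lemma spans_reindex V (I J : finType)
    (e : I -> V) (e' : J -> V) (h : I -> J) :
  spans e -> (forall i, e i = e' (h i)) -> spans e'.
Proof.
move=> eS eh v; have [c ->] := eS v.
exists (fun j => \sum_(i | h i == j) c i).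
rewrite (partition_big h xpredT) //=; apply: eq_bigr => j _.
by rewrite scaler_suml; apply: eq_bigr => i /eqP <-; rewrite eh.
Qed.

Lemma span_linear_eq V U (r : seq V) (f g : V -> U) :
  linear f -> linear g -> (forall w, w \in r -> f w = g w) ->
  forall w, w \in <<r>>%VS -> f w = g w.
Proof.
move=> fL gL fg w wr; rewrite (coord_span (X := in_tuple r) wr).
rewrite (linear_sumP fL) (linear_sumP gL); apply: eq_bigr => i _.
by rewrite fg // mem_nth.
Qed.

Lemma comp_lfun3 (V1 V2 V3 V4 : vectType k) (f : 'Hom(V3, V4))
    (g : 'Hom(V2, V3)) (h : 'Hom(V1, V2)) z :
  (f \o g \o h)%VF z = f (g (h z)).
Proof. by rewrite !comp_lfunE. Qed.

Lemma involutive_lfunV V (f : 'End(V)) :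
  (f \o f)%VF = \1%VF -> (f^-1)%VF = f.
Proof.
move=> ff; have fK : cancel f f by move=> v; rewrite -comp_lfunE ff id_lfunE.
apply/lfunP => v; rewrite -{1}(fK v) lker0_lfunK //.
apply/eqP/vspaceP => w; rewrite memv_ker memv0; apply/eqP/eqP => [w0|->].
  by rewrite -(fK w) w0 linear0.
by rewrite linear0.
Qed.

Lemma lfun_bijective V W (f : 'Hom(W, V)) :
  lker f == 0%VS -> \dim {:W} = \dim {:V} -> bijective f.
Proof.
move=> f0 dWV; have fI : limg f = fullv.
  by apply/eqP; rewrite eqEdim subvf -dWV limg_dim_eq ?(eqP f0) ?capv0 /=.
exists f^-1%VF; first exact: lker0_lfunK.
by move=> v; apply: limg_lfunVK; rewrite fI memvf.
Qed.

Lemma dim_dual V : \dim {: 'Hom(V, k^o)} = \dim {: V}.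
Proof. by rewrite !dimvf /dim /= muln1. Qed.

(** A spanning family with a dual family of coordinate forms is a basis. *)
Lemma dim_dual_basis (I : finType) V (e : I -> V)
    (coord : I -> 'Hom(V, k^o)) :
  spans e -> (forall i j, coord i (e j) = (j == i)%:R) -> \dim {: V} = #|I|.
Proof.
move=> eS eE; pose T := linfun (fun v : V => [ffun i => coord i v] : {ffun I -> k^o}).
have TE v : T v = [ffun i => coord i v].
  by rewrite /T linfunE // => a u w; apply/ffunP => i; rewrite !ffunE linearP.
have Te c : T (\sum_i c i *: e i) = [ffun i => c i].
  rewrite TE; apply/ffunP => i; rewrite !ffunE (linear_sumP (linearP _)).
  rewrite (bigD1 i) //= big1 ?addr0 => [|j /negPf jN]; rewrite eE ?eqxx ?jN.
    exact: mulr1.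
  exact: mulr0.
have T0 : lker T = 0%VS.
  apply/vspaceP => v; rewrite memv_ker memv0; apply/eqP/eqP => [|->]; last first.
    by rewrite linear0.
  have [c ->] := eS v; rewrite Te => /ffunP c0.
  by rewrite big1 // => i _; have := c0 i; rewrite !ffunE => ->; rewrite scale0r.
have TI : limg T = fullv.
  apply/vspaceP => u; rewrite memvf; apply/memv_imgP.
  exists (\sum_i u i *: e i); first exact: memvf.
  by rewrite Te; apply/ffunP => i; rewrite ffunE.
rewrite -(limg_dim_eq (f := T)) ?T0 ?capv0 // TI dimvf.
by rewrite /dim /= muln1.
Qed.

End TensorMaps.

(** * Sections of groupoid algebras *)

Section Sections.
Context {k : fieldType}.

(** The element of a groupoid algebra carried by a scalar and an arrow chosen
    at every object: the arrow at [o] is [m o], with coefficient [c o]. *)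
Definition sec (O : finType) (A : Type) (X : lmodType k) (E : O -> A -> X)
    (c : O -> k) (m : O -> A) : X :=
  \sum_o c o *: E o (m o).

Lemma eq_sec (O : finType) (A : Type) (X : lmodType k) (E : O -> A -> X)
    c c' m m' :
  c =1 c' -> m =1 m' -> sec E c m = sec E c' m'.
Proof. by move=> Ec Em; apply: eq_bigr => o _; rewrite Ec Em. Qed.

Lemma sum_delta (O : finType) (X : lmodType k) (c : O -> k) (F : O -> X) j :
  \sum_i c i *: ((i == j)%:R *: F i) = c j *: F j.
Proof.
rewrite (bigD1 j) //= eqxx scale1r big1 ?addr0 // => i /negPf->.
by rewrite scale0r scaler0.
Qed.

Lemma sec_delta (O : finType) (A : Type) (X : lmodType k) (E : O -> A -> X) o g :
  sec E (fun i => (i == o)%:R) (fun=> g) = E o g.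
Proof.
rewrite /sec; under eq_bigr => i _ do rewrite -[_%:R *: _]scale1r.
by rewrite (sum_delta (fun=> 1)) scale1r.
Qed.

Lemma lin_sec (O : finType) (A : Type) (X : vectType k) (Y : vectType k)
    (E : O -> A -> X) (f : X -> Y) c m :
  linear f -> f (sec E c m) = sec (fun o g => f (E o g)) c m.
Proof. by move=> fL; rewrite /sec linear_sumP. Qed.

Lemma lfun_sec (O : finType) (A : Type) (X Y : vectType k) (E : O -> A -> X)
    (f : 'Hom(X, Y)) c m :
  f (sec E c m) = sec (fun o g => f (E o g)) c m.
Proof. exact: lin_sec (linearP f). Qed.

(** Only the term of the second factor sitting at the target of the arrow
    [m o] survives, so the product is again a section. *)
Lemma sec_mul (O : finType) (A : finGroupType) (X : vectType k)
    (E : O -> A -> X) (tgt : O -> A -> O) (mul : X -> X -> X) c m c' m' :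
  bilin mul ->
  (forall o g o' g', mul (E o g) (E o' g')
     = (o' == tgt o g)%:R *: E o (g * g')%g) ->
  mul (sec E c m) (sec E c' m') =
  sec E (fun o => c o * c' (tgt o (m o))) (fun o => m o * m' (tgt o (m o)))%g.
Proof.
move=> [mL mR] mulE; rewrite {1}/sec (linear_sumP (mL _)).
apply: eq_bigr => o _; rewrite (linear_sumP (mR _)) -scalerA; congr (_ *: _).
under eq_bigr => i _ do rewrite mulE.
exact: sum_delta.
Qed.

Lemma sec_eq (O : finType) (A : finType) (X Y : vectType k) (E : O -> A -> X)
    (f g : X -> Y) :
  spans (fun i : O * A => E i.1 i.2) -> linear f -> linear g ->
  (forall c m, f (sec E c m) = g (sec E c m)) -> f =1 g.
Proof.
move=> ES fL gL fg; apply: (spans_eq ES) => // - [o a] /=.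
by rewrite -sec_delta.
Qed.

End Sections.

(** * Bismash products *)

(** A right action [rr] of the arrows on the set of objects and a left action
    [ll] of the objects on the set of arrows, subject to the conditions under
    which objects times arrows is again a group. *)
Record matched_pair (S A : finGroupType) (rr : S -> A -> S) (ll : S -> A -> A) :
    Prop := MatchedPair {
  mp_rr1 : forall o, rr o 1%g = o;
  mp_rrM : forall o g h, rr o (g * h)%g = rr (rr o g) h;
  mp_ll1 : forall g, ll 1%g g = g;
  mp_llM : forall o o' g, ll (o * o')%g g = ll o (ll o' g);
  mp_rrMl : forall o o' g, rr (o * o')%g g = (rr o (ll o' g) * rr o' g)%g;
  mp_llMr : forall o g h, ll o (g * h)%g = (ll o g * ll (rr o g) h)%g
}.

(** [H] is the bismash product of functions on [S] with the group algebra of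
    [A], the vector [e o g] standing for the delta function at [o] times [g].
    A spanning family suffices to test the Hopf algebra axioms; linear
    independence enters only through dual coordinate forms. *)
Record is_bismash (k : fieldType) (V : vectType k) (H : hopf_ops V)
    (S A : finGroupType) (rr : S -> A -> S) (ll : S -> A -> A)
    (e : S -> A -> V) : Prop := IsBismash {
  bm_spans : spans (fun i : S * A => e i.1 i.2);
  bm_mul : forall o g o' g',
    hprod H (e o g) (e o' g') = (o' == rr o g)%:R *: e o (g * g')%g;
  bm_one : hone H = \sum_o e o 1%g;
  bm_comul : forall o g,
    hcomul H (e o g) = \sum_o2 tens (e (o * o2^-1)%g (ll o2 g)) (e o2 g);
  bm_counit : forall o g, hcounit H (e o g) = (o == 1%g)%:R;
  bm_anti : forall o g, hanti H (e o g) = e (rr o g)^-1%g (ll o g)^-1%g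
}.

Section Bismash.
Context {k : fieldType} {V : vectType k} (H : hopf_ops V).
Context {S A : finGroupType} (rr : S -> A -> S) (ll : S -> A -> A).
Context (e : S -> A -> V).
Hypothesis mp : matched_pair rr ll.
Hypothesis bm : is_bismash H rr ll e.

Lemma mp_rr1l g : rr 1%g g = 1%g.
Proof.
have := mp_rrMl mp 1%g 1%g g; rewrite mulg1 (mp_ll1 mp) => /eqP.
by rewrite -[X in X == _]mulg1 (inj_eq (mulgI _)) => /eqP.
Qed.

Lemma mp_ll1r o : ll o 1%g = 1%g.
Proof.
have := mp_llMr mp o 1%g 1%g; rewrite mulg1 (mp_rr1 mp) => /eqP.
by rewrite -[X in X == _]mulg1 (inj_eq (mulgI _)) => /eqP.
Qed.

Lemma mp_rrK g : cancel (rr^~ g) (rr^~ g^-1%g).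
Proof. by move=> o; rewrite -(mp_rrM mp) mulgV (mp_rr1 mp). Qed.

Lemma mp_rrI g : injective (rr^~ g).
Proof. exact: can_inj (mp_rrK g). Qed.

(** The antipode sends an arrow out of [o] to an arrow ending at [o^-1]. *)
Lemma mp_rrV o g : rr ((rr o g)^-1)%g (ll o g)^-1%g = o^-1%g.
Proof.
have : (rr o^-1 (ll o g) * rr o g)%g == 1%g.
  by rewrite -(mp_rrMl mp) mulVg mp_rr1l.
rewrite -eq_invg_mul => /eqP/(canRL invgK) <-; exact: mp_rrK.
Qed.

(** The tensor square and cube are groupoid algebras for the product groups, so
    the calculus of sections applies to them as well. *)
Definition e2 (o : S * S) (g : A * A) : tensor V V :=
  tens (e o.1 g.1) (e o.2 g.2).
Definition e3 (o : S * S * S) (g : A * A * A) : tensor (tensor V V) V :=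
  tens (e2 o.1 g.1) (e o.2 g.2).

Definition rr2 (o : S * S) (g : A * A) := (rr o.1 g.1, rr o.2 g.2).
Definition rr3 (o : S * S * S) (g : A * A * A) := (rr2 o.1 g.1, rr o.2 g.2).

Lemma tprod_bilin : bilin (tprod H).
Proof. by rewrite /tprod; bil. Qed.

Lemma tprod3_bilin : bilin (tprod3 H).
Proof. by rewrite /tprod3; bil. Qed.

Lemma sec1M c m c' m' :
  hprod H (sec e c m) (sec e c' m') =
  sec e (fun o => c o * c' (rr o (m o))) (fun o => m o * m' (rr o (m o)))%g.
Proof. exact: sec_mul (hprod_bilin H) (bm_mul bm). Qed.

Lemma e2M o g o' g' :
  tprod H (e2 o g) (e2 o' g') = (o' == rr2 o g)%:R *: e2 o (g * g')%g.
Proof.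
case: o g o' g' => [o1 o2] [g1 g2] [o1' o2'] [g1' g2'].
rewrite /e2 tprodE !(bm_mul bm) tensZl tensZr scalerA -natrM mulnb.
by rewrite xpair_eqE.
Qed.

Lemma sec2M c m c' m' :
  tprod H (sec e2 c m) (sec e2 c' m') =
  sec e2 (fun o => c o * c' (rr2 o (m o))) (fun o => m o * m' (rr2 o (m o)))%g.
Proof. exact: sec_mul tprod_bilin e2M. Qed.

Lemma e3M o g o' g' :
  tprod3 H (e3 o g) (e3 o' g') = (o' == rr3 o g)%:R *: e3 o (g * g')%g.
Proof.
case: o g o' g' => [[o1 o2] o3] [[g1 g2] g3] [[o1' o2'] o3'] [[g1' g2'] g3'].
rewrite /e3 /e2 tprod3E !(bm_mul bm) !(tensZl, tensZr) !scalerA -!natrM !mulnb.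
rewrite !xpair_eqE.
by case: (o1' == _); case: (o2' == _); case: (o3' == _).
Qed.

Lemma sec3M c m c' m' :
  tprod3 H (sec e3 c m) (sec e3 c' m') =
  sec e3 (fun o => c o * c' (rr3 o (m o))) (fun o => m o * m' (rr3 o (m o)))%g.
Proof. exact: sec_mul tprod3_bilin e3M. Qed.

Lemma sec_one : hone H = sec e (fun=> 1) (fun=> 1%g).
Proof. by rewrite (bm_one bm); apply: eq_bigr => o _; rewrite scale1r. Qed.

Lemma sec_tens c m c' m' :
  tens (sec e c m) (sec e c' m') =
  sec e2 (fun o => c o.1 * c' o.2) (fun o => (m o.1, m' o.2)).
Proof.
rewrite {1}/sec (linear_sumP (tens_linl _)).
under eq_bigr => i _ do rewrite (linear_sumP (tens_linr _)) scaler_sumr.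
by rewrite pair_big; apply: eq_bigr => o _; rewrite scalerA.
Qed.

Lemma sec_tens2 c m c' m' :
  tens (sec e2 c m) (sec e c' m') =
  sec e3 (fun o => c o.1 * c' o.2) (fun o => (m o.1, m' o.2)).
Proof.
rewrite {1}/sec (linear_sumP (tens_linl _)).
under eq_bigr => i _ do rewrite (linear_sumP (tens_linr _)) scaler_sumr.
by rewrite pair_big; apply: eq_bigr => o _; rewrite scalerA.
Qed.

Lemma sec_tone : tone H = sec e2 (fun=> 1) (fun=> 1%g).
Proof. by rewrite /tone sec_one sec_tens; apply: eq_sec => //= o; rewrite mulr1. Qed.

Lemma sec_flip c m :
  tflip V V (sec e2 c m) =
  sec e2 (fun o => c (o.2, o.1)) (fun o => ((m (o.2, o.1)).2, (m (o.2, o.1)).1)).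
Proof.
rewrite lfun_sec {1}/sec.
rewrite (reindex_inj (h := fun o : S * S => (o.2, o.1))); last first.
  by case=> [? ?] [? ?] [-> ->].
by apply: eq_bigr => - [o1 o2] _; rewrite /e2 tflipE.
Qed.

(** Summing over pairs of objects instead of over factorisations of one object
    turns the coproduct of a section into a section. *)
Lemma sec_comul c m :
  hcomul H (sec e c m) =
  sec e2 (fun o => c (o.1 * o.2)%g)
    (fun o => (ll o.2 (m (o.1 * o.2)), m (o.1 * o.2)))%g.
Proof.
rewrite lfun_sec /sec.
under eq_bigr => o _ do rewrite (bm_comul bm) scaler_sumr.
rewrite exchange_big /= (eq_bigr (fun o2 => \sum_o1 c (o1 * o2)%g *:
  e2 (o1, o2) (ll o2 (m (o1 * o2)), m (o1 * o2))%g)).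
  by rewrite exchange_big pair_big.
move=> o2 _; rewrite (reindex_inj (mulIg o2)); apply: eq_bigr => o1 _.
by rewrite mulgK.
Qed.

Lemma sec_comull C M :
  tmap (hcomul H) \1%VF (sec e2 C M) =
  sec e3 (fun o => C (o.1.1 * o.1.2, o.2))%g
    (fun o => let g := M (o.1.1 * o.1.2, o.2)%g in
      ((ll o.1.2 g.1, g.1), g.2)).
Proof.
rewrite lfun_sec /sec.
rewrite (eq_bigr (fun o : S * S => \sum_y C o *:
  e3 ((o.1 * y^-1, y), o.2)%g ((ll y (M o).1, (M o).1), (M o).2))); last first.
  move=> o _; rewrite /e2 tmapE (bm_comul bm) id_lfunE -scaler_sumr; congr (_ *: _).
  by rewrite (lin_sum1 (tens_linl _)).
rewrite exchange_big /= (eq_bigr (fun y => \sum_(o : S * S) C (o.1 * y, o.2)%g *: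
  e3 ((o.1, y), o.2)%g
    (let g := M (o.1 * y, o.2)%g in ((ll y g.1, g.1), g.2)))); last first.
  move=> y _; rewrite (reindex_inj (h := fun o => (o.1 * y, o.2)%g)).
    by apply: eq_bigr => o _; rewrite mulgK.
  by move=> [? ?] [? ?] [/mulIg -> ->].
rewrite exchange_big pair_big /=.
rewrite (reindex_inj (h := fun o : S * S * S => ((o.1.1, o.2), o.1.2))) //.
by move=> [[? ?] ?] [[? ?] ?] [-> -> ->].
Qed.

Lemma sec_comulr C M :
  tassoc V V V (tmap \1%VF (hcomul H) (sec e2 C M)) =
  sec e3 (fun o => C (o.1.1, o.1.2 * o.2))%g
    (fun o => let g := M (o.1.1, o.1.2 * o.2)%g in
      ((g.1, ll o.2 g.2), g.2)).
Proof.
rewrite !lfun_sec /sec.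
rewrite (eq_bigr (fun o : S * S => \sum_y C o *:
  e3 ((o.1, o.2 * y^-1), y)%g (((M o).1, ll y (M o).2), (M o).2))); last first.
  move=> o _; rewrite /e2 tmapE (bm_comul bm) id_lfunE -scaler_sumr; congr (_ *: _).
  rewrite (lin_sum1 (tens_linr _)) lfun_sum.
  by apply: eq_bigr => y _; rewrite tassocE.
rewrite exchange_big /= (eq_bigr (fun y => \sum_(o : S * S) C (o.1, o.2 * y)%g *:
  e3 ((o.1, o.2), y)%g
    (let g := M (o.1, o.2 * y)%g in ((g.1, ll y g.2), g.2)))); last first.
  move=> y _; rewrite (reindex_inj (h := fun o => (o.1, o.2 * y)%g)).
    by apply: eq_bigr => o _; rewrite mulgK.
  by move=> [? ?] [? ?] [-> /mulIg ->].
rewrite exchange_big pair_big /=.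
by apply: eq_bigr => - [[? ?] ?].
Qed.

Lemma sec_ext (X : vectType k) (f g : V -> X) :
  linear f -> linear g ->
  (forall c m, f (sec e c m) = g (sec e c m)) -> f =1 g.
Proof. exact: sec_eq (bm_spans bm). Qed.

Lemma sec_counit c m : hcounit H (sec e c m) = c 1%g.
Proof.
rewrite lfun_sec /sec (bigD1 1%g) //= (bm_counit bm) eqxx.
rewrite big1 ?addr0 => [|o /negPf oN]; first exact: mulr1.
by rewrite (bm_counit bm) oN scaler0.
Qed.

(** The term of the coproduct indexed by o1 o2 = o contributes zero unless
    o2 = o1^-1, that is unless o = 1; in this case the terms are the summands of
    the unit, permuted by [rr^~ g]. *)
Lemma sec_antil o g :
  tlift (fun a b => hprod H (hanti H a) b) (hcomul H (e o g)) =
  (hcounit H (e o g) : k) *: hone H.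
Proof.
rewrite (bm_comul bm) (bm_counit bm) (bm_one bm) lfun_sum.
case: eqP => [->|/eqP oN]; last first.
  rewrite scale0r big1 // => o2 _; rewrite tliftE ?(bm_anti bm) ?(bm_mul bm); last bil.
  rewrite mp_rrV; case: eqP => [E|]; last by rewrite scale0r.
  move/eqP: E; rewrite invMg invgK -[X in X == _]mulg1 (inj_eq (mulgI _)).
  by rewrite eq_sym eq_invg1 (negPf oN).
rewrite scale1r [RHS](reindex_inj (mp_rrI (g := g))); apply: eq_bigr => o2 _.
rewrite tliftE ?(bm_anti bm) ?(bm_mul bm); last bil.
rewrite mp_rrV mul1g invgK eqxx scale1r -(mp_llM mp) mulVg (mp_ll1 mp) mulVg.
congr (e _ _); have := mp_rrMl mp (o2^-1)%g o2 g.
by rewrite mulVg mp_rr1l => /esym/eqP; rewrite -eq_invg_mul => /eqP.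
Qed.

Lemma sec_antir o g :
  tlift (fun a b => hprod H a (hanti H b)) (hcomul H (e o g)) =
  (hcounit H (e o g) : k) *: hone H.
Proof.
rewrite (bm_comul bm) (bm_counit bm) (bm_one bm) lfun_sum.
have rrE o2 : (rr o2 g)^-1%g == rr (o * o2^-1)%g (ll o2 g) = (o == 1%g).
  rewrite -(inj_eq (mulIg (rr o2 g))) -(mp_rrMl mp) mulVg mulgKV.
  by rewrite -(inj_eq (mp_rrI (g := g))) mp_rr1l eq_sym.
case: eqP => [E|/eqP oN]; last first.
  rewrite scale0r big1 // => o2 _; rewrite tliftE ?(bm_anti bm) ?(bm_mul bm); last bil.
  by rewrite rrE (negPf oN) scale0r.
rewrite scale1r [RHS](reindex_inj invg_inj); apply: eq_bigr => o2 _.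
rewrite tliftE ?(bm_anti bm) ?(bm_mul bm); last bil.
by rewrite rrE E eqxx scale1r mul1g mulgV.
Qed.

Lemma bismash_is_hopf : is_hopf H.
Proof.
split.
- move=> x y z; move: x; apply: sec_ext; [by lin|by lin|move=> c m].
  move: y; apply: sec_ext; [by lin|by lin|move=> c' m'].
  move: z; apply: sec_ext; [by lin|by lin|move=> c'' m''].
  by rewrite !sec1M; apply: eq_sec => o; rewrite (mp_rrM mp) ?mulrA ?mulgA.
- apply: sec_ext; [by lin|by lin|move=> c m].
  by rewrite sec_one sec1M; apply: eq_sec => o; rewrite (mp_rr1 mp) ?mul1r ?mul1g.
- apply: sec_ext; [by lin|by lin|move=> c m].
  by rewrite sec_one sec1M; apply: eq_sec => o; rewrite ?mulr1 ?mulg1.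
- apply: sec_ext; [by lin|by lin|move=> c m].
  rewrite sec_comul sec_comull sec_comulr; apply: eq_sec => o /=; rewrite mulgA //.
  by rewrite (mp_llM mp).
- apply: sec_ext; [by lin|by lin|move=> c m].
  rewrite sec_comul lfun_sec {1}/sec -(pair_bigA _ (fun o1 o2 => 
   c (o1 * o2)%g *: tlift (fun a b => (hcounit H a : k) *: b) 
      (e2 (o1, o2) (ll o2 (m (o1 * o2)), m (o1 * o2))%g))) /=.
  rewrite (bigD1 1%g) //= [X in _ + X]big1 ?addr0 => [|o1 /negPf oN]; last first.
    rewrite big1 // => o2 _; rewrite /e2 tliftE; last bil.
    by rewrite (bm_counit bm) oN scale0r scaler0.
  apply: eq_bigr => o2 _; rewrite /e2 tliftE; last bil.
  by rewrite (bm_counit bm) eqxx scale1r mul1g.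
- apply: sec_ext; [by lin|by lin|move=> c m].
  rewrite sec_comul lfun_sec {1}/sec -(pair_bigA _ (fun o1 o2 => 
   c (o1 * o2)%g *: tlift (fun a b => (hcounit H b : k) *: a) 
      (e2 (o1, o2) (ll o2 (m (o1 * o2)), m (o1 * o2))%g))) /=.
  apply: eq_bigr => o1 _.
  rewrite (bigD1 1%g) //= [X in _ + X]big1 ?addr0 => [|o2 /negPf oN]; last first.
    rewrite /e2 tliftE; last bil.
    by rewrite (bm_counit bm) oN scale0r scaler0.
  rewrite /e2 tliftE; last bil.
  by rewrite (bm_counit bm) eqxx scale1r mulg1 /= (mp_ll1 mp).
- rewrite sec_tone sec_one sec_comul; apply: eq_sec => //= o.
  by rewrite mp_ll1r.
- move=> x y; move: x; apply: sec_ext; [by lin|by rewrite /tprod; lin|move=> c m].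
  move: y; apply: sec_ext; [by lin|by rewrite /tprod; lin|move=> c' m'].
  rewrite sec1M !sec_comul sec2M; apply: eq_sec => o /=.
    by rewrite (mp_rrMl mp).
  by rewrite -!(mp_rrMl mp) (mp_llMr mp).
- by rewrite sec_one sec_counit.
- move=> x y; move: x; apply: sec_ext; [by lin|by lin|move=> c m].
  move: y; apply: sec_ext; [by lin|by lin|move=> c' m'].
  by rewrite sec1M !sec_counit mp_rr1l.
- apply: (spans_eq (bm_spans bm)); [by lin|by lin|move=> - [o g]].
  exact: sec_antil.
- apply: (spans_eq (bm_spans bm)); [by lin|by lin|move=> - [o g]].
  exact: sec_antir.
Qed.

End Bismash.

(** * The R-matrix and the ribbon element *)

Lemma pairM (A B : finGroupType) (a c : A) (b d : B) :
  ((a, b) * (c, d) = (a * c, b * d))%g.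
Proof. by []. Qed.

Lemma pair1 (A B : finGroupType) : (1 = (1, 1) :> A * B)%g.
Proof. by []. Qed.

Lemma pairV (A B : finGroupType) (a : A) (b : B) :
  ((a, b)^-1 = (a^-1, b^-1))%g.
Proof. by []. Qed.

(** Normalises words in a group by free reduction. *)
Ltac grp :=
  rewrite /= ?(invMg, invgK, invg1) -?mulgA
    ?(mulKg, mulKVg, mulgV, mulVg, mulg1, mul1g, invg1).

(** Rewriting rules that move [x] to the left of [y] in words written with
    right-nested products. *)
Lemma commute_rules (gT : finGroupType) (x y : gT) :
  commute y x ->
  ((y * x = x * y)%g * (forall z, y * (x * z) = x * (y * z))%g *
   (y^-1 * x = x * y^-1)%g * (forall z, y^-1 * (x * z) = x * (y^-1 * z))%g *
   (y * x^-1 = x^-1 * y)%g * (forall z, y * (x^-1 * z) = x^-1 * (y * z))%g *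
   (y^-1 * x^-1 = x^-1 * y^-1)%g *
   (forall z, y^-1 * (x^-1 * z) = x^-1 * (y^-1 * z))%g)%type.
Proof.
move=> cyx; have cyV : commute y x^-1 by apply: commuteV.
have cVx : commute y^-1 x by apply/commute_sym/commuteV/commute_sym.
have cVV : commute y^-1 x^-1 by apply: commuteV.
by do !split; move=> *; rewrite ?mulgA (cyx, cyV, cVx, cVV).
Qed.

Ltac grpcomm c :=
  let sw := fresh in
  pose proof (commute_rules c) as sw;
  rewrite /= ?(invMg, invgK, invg1) -?mulgA
    ?(mulKg, mulKVg, mulgV, mulVg, mulg1, mul1g, invg1, sw).

Ltac grpcomm3 c c' c'' :=
  let sw := fresh in let sw' := fresh in let sw'' := fresh in
  pose proof (commute_rules c) as sw; pose proof (commute_rules c') as sw';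
  pose proof (commute_rules c'') as sw'';
  rewrite /= ?(invMg, invgK, invg1) -?mulgA
    ?(mulKg, mulKVg, mulgV, mulVg, mulg1, mul1g, invg1, sw, sw', sw'').

(** Objects (v, f) and arrows g: an object acts on arrows by conjugation with
    [theta f], and an arrow acts on the first component of an object by
    twisted conjugation. *)
Section Conjugation.
Context {gT fT : finGroupType} (theta : fT -> gT).
Hypothesis thetaM : forall f n, theta (f * n)%g = (theta f * theta n)%g.

Definition conj_ll (o : gT * fT) (g : gT) : gT :=
  (theta o.2 * g * (theta o.2)^-1)%g.
Definition conj_rr (o : gT * fT) (g : gT) : gT * fT :=
  ((conj_ll o g)^-1 * o.1 * g, o.2)%g.

Lemma theta1 : theta 1%g = 1%g.
Proof. by apply: (mulgI (theta 1%g)); rewrite -thetaM !mulg1. Qed.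

Lemma thetaV f : theta f^-1%g = (theta f)^-1%g.
Proof. by apply: (mulgI (theta f)); rewrite -thetaM !mulgV theta1. Qed.

Lemma conj_matched_pair : matched_pair conj_rr conj_ll.
Proof.
split; rewrite /conj_rr /conj_ll.
- by case=> v f /=; grp.
- by case=> v f g h /=; congr pair; grp.
- by move=> g; rewrite /= theta1; grp.
- by case=> v f [h n] g /=; rewrite thetaM; grp.
- by case=> v f [h n] g /=; congr pair; rewrite thetaM; grp.
- by case=> v f g h /=; grp.
Qed.

End Conjugation.

Section ConjugationBismash.
Context {k : fieldType} {gT fT : finGroupType} (theta : fT -> gT).
Context (beta : fT -> fT -> k).
Hypothesis fC : forall f n : fT, (f * n = n * f)%g.
Hypothesis thetaM : forall f n, theta (f * n)%g = (theta f * theta n)%g.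
Hypothesis betaM : forall f f' n, beta (f * f')%g n = beta f n * beta f' n.
Hypothesis betaC : forall f n, beta f n = beta n f.
Hypothesis beta1 : forall f, beta f 1%g = 1.

Context {V : vectType k} (H : hopf_ops V) (e : gT * fT -> gT -> V).
Local Notation rr := (conj_rr theta).
Local Notation ll := (conj_ll theta).
Hypothesis bm : is_bismash H rr ll e.

Let thetaC f n : (theta f * theta n = theta n * theta f)%g.
Proof. by rewrite -!thetaM fC. Qed.

Let thetaCl f n z : (theta f * (theta n * z) = theta n * (theta f * z))%g.
Proof. by rewrite !mulgA thetaC. Qed.

Let tV := thetaV thetaM.

Ltac grpC := grp => //; rewrite -?tV (thetaCl, thetaC) ?tV; grp => //.

Lemma beta1l f : beta 1%g f = 1.
Proof. by rewrite betaC beta1. Qed.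

Lemma betaMr f n n' : beta f (n * n')%g = beta f n * beta f n'.
Proof. by rewrite !(betaC f) betaM. Qed.

Lemma beta_neq0 f n : beta f n != 0.
Proof.
apply/eqP => b0; have := oner_neq0 k.
by rewrite -(beta1l n) -(mulgV f) betaM b0 mul0r eqxx.
Qed.

Lemma betaV f n : beta f^-1%g n = (beta f n)^-1.
Proof.
apply: (mulfI (beta_neq0 f n)); rewrite -betaM mulgV beta1l mulfV //.
exact: beta_neq0.
Qed.

(** The image of the R-matrix of the double in the quotient; see
    [quot_doubleR]. *)
Definition conjR : tensor V V :=
  sec (e2 e) (fun o => (beta o.1.2 o.2.2)^-1)
    (fun o => ((theta o.2.2)^-1%g, o.1.1)).

(** The inverse of an R-matrix is obtained by applying the antipode to its first
    factor. *)
Definition conjRinv : tensor V V :=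
  sec (e2 e) (fun o => beta o.1.2 o.2.2)
    (fun o => (theta o.2.2, ((theta o.2.2)^-1 * o.1.1^-1 * theta o.2.2)%g)).

Lemma conjR_inv : tinverse H conjR conjRinv.
Proof.
split; rewrite (sec2M bm) (sec_tone bm); apply: eq_sec => - [[v f] [h n]] /=.
- by rewrite mulVf ?beta_neq0.
- rewrite pairM [RHS]pair1; congr pair; rewrite /conj_rr /conj_ll; grpC.
- by rewrite mulfV ?beta_neq0.
- rewrite pairM [RHS]pair1; congr pair; rewrite /conj_rr /conj_ll; grpC.
Qed.

Lemma sec_R13 C M :
  R13 H (sec (e2 e) C M) =
  sec (e3 e) (fun o => C (o.1.1, o.2))
    (fun o => let g := M (o.1.1, o.2) in ((g.1, 1%g), g.2)).
Proof.
rewrite /R13 lfun_sec /sec (bm_one bm).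
rewrite (eq_bigr (fun o : (gT * fT) * (gT * fT) => \sum_y C o *:
  e3 e ((o.1, y), o.2) (((M o).1, 1%g), (M o).2))); last first.
  move=> o _; rewrite /e2 tliftE; last bil.
  rewrite -scaler_sumr; congr (_ *: _).
  by rewrite (lin_sum1 (tens_linr _)) (lin_sum1 (tens_linl _)).
rewrite pair_big /=.
rewrite (reindex_inj (h := fun o : (gT * fT) * (gT * fT) * (gT * fT) =>
   ((o.1.1, o.2), o.1.2))) //.
by apply: (can_inj (g := fun o => ((o.1.1, o.2), o.1.2))) => - [[? ?] ?].
Qed.

Lemma sec_R23 C M :
  R23 H (sec (e2 e) C M) =
  sec (e3 e) (fun o => C (o.1.2, o.2))
    (fun o => let g := M (o.1.2, o.2) in ((1%g, g.1), g.2)).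
Proof.
rewrite /R23 lfun_sec /sec (bm_one bm).
rewrite (eq_bigr (fun o : (gT * fT) * (gT * fT) => \sum_y C o *:
  e3 e ((y, o.1), o.2) ((1%g, (M o).1), (M o).2))); last first.
  move=> o _; rewrite /e2 tliftE; last bil.
  rewrite -scaler_sumr; congr (_ *: _).
  by rewrite (lin_sum1 (tens_linl _)) (lin_sum1 (tens_linl _)).
rewrite pair_big /=.
rewrite (reindex_inj (h := fun o : (gT * fT) * (gT * fT) * (gT * fT) =>
   ((o.1.2, o.2), o.1.1))) //.
by apply: (can_inj (g := fun o => ((o.2, o.1.1), o.1.2))) => - [[? ?] ?].
Qed.

Lemma sec_R12 C M :
  R12 H (sec (e2 e) C M) =
  sec (e3 e) (fun o => C o.1) (fun o => (M o.1, 1%g)).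
Proof.
rewrite /R12 (sec_one bm) sec_tens2; apply: eq_sec => o //=.
by rewrite mulr1.
Qed.

(** The targets of the two arrows of [conjR] at a pair of objects multiply to
    the product of these objects in the opposite order: this is why [conjR]
    intertwines the coproduct with its opposite. *)
Lemma braid v f h n :
  (rr (v, f) (theta n)^-1 * rr (h, n) v = (h, n) * (v, f))%g.
Proof. by rewrite /conj_rr !pairM fC /conj_ll; congr pair; grpC. Qed.

Lemma conjR_quasitriangular : is_quasitriangular H conjR.
Proof.
split.
- by exists conjRinv; exact: conjR_inv.
- apply: (sec_ext bm); [by rewrite /tprod; lin|by rewrite /tprod; lin|move=> c m].
  rewrite (sec_comul bm) sec_flip !(sec2M bm).
  by apply: eq_sec => - [[v f] [h n]] /=; rewrite braid ?(mulrC _^-1) // !pairM;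
    congr pair; rewrite /conj_rr /conj_ll; grp.
- rewrite (sec_comull bm) sec_R13 sec_R23 (sec3M bm).
  apply: eq_sec => - [[[v f] [h n]] [w l]] /=; rewrite /conj_rr /conj_ll.
    by rewrite betaM invfM.
  by rewrite !pairM; congr (_, _, _); grpC.
- rewrite (sec_comulr bm) sec_R13 sec_R12 (sec3M bm).
  apply: eq_sec => - [[[v f] [h n]] [w l]] /=; rewrite /conj_rr /conj_ll.
    by rewrite betaMr invfM mulrC.
  by rewrite !pairM; congr (_, _, _); rewrite /= ?thetaM; grp => //; grpC.
Qed.

Definition conjM : tensor V V :=
  sec (e2 e) (fun o => (beta o.1.2 o.2.2)^-2)
    (fun o => ((o.2.1 * (theta o.2.2)^-1)%g,
               (o.2.1^-1 * (theta o.1.2)^-1 * o.1.1 * o.2.1)%g)).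

Lemma conj_monodromy : monodromy H conjR = conjM.
Proof.
rewrite /monodromy sec_flip (sec2M bm).
apply: eq_sec => - [[v f] [h n]] /=; rewrite /conj_rr /conj_ll.
  by rewrite (betaC n f) -invfM -expr2.
by congr pair; grp.
Qed.

(** The arrow at every object is a loop; this makes [conju] central. *)
Definition conju : V :=
  sec e (fun o => beta o.2 o.2) (fun o => (o.1^-1 * theta o.2)%g).

Lemma conj_drinfeld : drinfeld_elt H conjR = conju.
Proof.
rewrite /drinfeld_elt lfun_sec /sec.
(* The antipode of the second factor composes with the first one only when
   [o1 = o2^-1]. *)
transitivity (\sum_(o2 : gT * fT) \sum_(o1 : gT * fT) (beta o1.2 o2.2)^-1 *:
   ((o1 == o2^-1)%g%:R *:
    e (rr o2 o1.1)^-1%g ((ll o2 o1.1)^-1 * (theta o2.2)^-1)%g)).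
  rewrite exchange_big pair_big; apply: eq_bigr => o _.
  rewrite /e2 tliftE ?(bm_anti bm) ?(bm_mul bm); last bil.
  by rewrite (mp_rrV (conj_matched_pair thetaM)).
under eq_bigr => o2 _ do rewrite sum_delta.
rewrite /conju /sec.
rewrite [RHS](reindex_inj (h := fun o : gT * fT =>
  ((theta o.2 * o.1^-1 * (theta o.2)^-1)%g, o.2^-1%g))); last first.
  by move=> [v f] [h n] /= [/[swap] /invg_inj -> /mulIg/mulgI/invg_inj ->].
apply: eq_bigr => - [v f] _ /=.
rewrite !betaV betaC betaV invrK; congr (_ *: e _ _); rewrite /conj_rr /conj_ll.
  by congr pair; grp.
by rewrite tV; grp.
Qed.

Lemma conju_central y : hprod H conju y = hprod H y conju.
Proof.
move: y; apply: (sec_ext bm); [by lin|by lin|move=> c m].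
rewrite !(sec1M bm); apply: eq_sec => - [v f] /=; rewrite /conj_rr /conj_ll /=.
  by rewrite mulrC; congr (c (pair _ _) * _); grp.
by grp.
Qed.

Lemma conju_anti : hanti H conju = conju.
Proof.
rewrite /conju lfun_sec /sec [RHS](reindex_inj invg_inj) /=.
apply: eq_bigr => - [v f] _; rewrite (bm_anti bm) /= betaV betaC betaV invrK.
by rewrite /conj_rr /conj_ll; congr (_ *: e _ _); rewrite ?tV //=; grp.
Qed.

Lemma conju_counit : hcounit H conju = 1.
Proof. by rewrite (sec_counit bm) /= beta1. Qed.

Definition conjMinv : tensor V V :=
  sec (e2 e) (fun o => beta o.1.2 o.2.2 ^+ 2)
    (fun o => (((theta o.1.2)^-1 * o.1.1 * theta o.2.2 * o.2.1^-1 *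
                o.1.1^-1 * theta o.1.2)%g,
               ((theta o.2.2)^-1 * o.1.1^-1 * theta o.2.2 * theta o.1.2)%g)).

Lemma conjM_inv : tinverse H conjM conjMinv.
Proof.
split; rewrite (sec2M bm) (sec_tone bm); apply: eq_sec => - [[v f] [h n]] /=.
- by rewrite mulVf // expf_neq0 ?beta_neq0.
- by rewrite !pairM [RHS]pair1; congr pair;
    rewrite /conj_rr /conj_ll; grpcomm (thetaC f n).
- by rewrite mulfV // expf_neq0 ?beta_neq0.
- by rewrite !pairM [RHS]pair1; congr pair;
    rewrite /conj_rr /conj_ll; grpcomm (thetaC f n).
Qed.

Lemma conj_comul_u : hcomul H conju = tprod H (tens conju conju) conjMinv.
Proof.
rewrite sec_tens (sec2M bm) (sec_comul bm).
apply: eq_sec => - [[v f] [h n]] /=.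
  rewrite betaM !betaMr (betaC n f) expr2; ring.
by rewrite pairM; congr pair; rewrite /conj_rr /conj_ll /= ?thetaM; grpcomm (thetaC f n).
Qed.

Lemma conj_ribbon : is_ribbon H conjR.
Proof.
exists conju; rewrite conj_drinfeld conju_anti; split=> //.
- exact: conju_central.
- exact: conju_counit.
- exists conjMinv; last exact: conj_comul_u.
  by rewrite conj_monodromy; exact: conjM_inv.
Qed.

End ConjugationBismash.

(** * Factorizability *)

Section Factorizable.
Context {k : fieldType} {V : vectType k}.

Context {gT fT : finGroupType} (theta : fT -> gT) (beta : fT -> fT -> k).
Hypothesis betaM : forall f f' n, beta (f * f')%g n = beta f n * beta f' n.
Hypothesis betaC : forall f n, beta f n = beta n f.
Hypothesis beta1 : forall f, beta f 1%g = 1.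
Hypothesis beta2_orth : forall f,
  \sum_n beta f n ^+ 2 = (f == 1%g)%:R * #|fT|%:R.
Hypothesis fT_neq0 : #|fT|%:R != 0 :> k.

Context (H : hopf_ops V) (e : gT * fT -> gT -> V).
Hypothesis bm : is_bismash H (conj_rr theta) (conj_ll theta) e.
Context (coord : gT * fT -> gT -> 'Hom(V, k^o)).
Hypothesis coordE : forall o g o' g',
  coord o g (e o' g') = ((o' == o) && (g' == g))%:R.

(** If the form [phi] is killed, each coordinate of its image gives one linear
    relation between the values of [phi] at e((theta f v, f); g), where [f]
    varies and [v], [g] are fixed.  The coefficients beta(f, n)^-2, for [n] in
    [F], form an invertible matrix. *)
Lemma conj_factorizable : is_factorizable H (conjR theta beta e).
Proof.
rewrite /is_factorizable (conj_monodromy betaC bm).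
set M := conjM theta beta e.
pose Phi := linfun (fun f : 'Hom(V, k^o) => tlift (fun a b => (f a : k) *: b) M).
have PhiE f : Phi f = tlift (fun a b => (f a : k) *: b) M.
  rewrite /Phi linfunE //; lin.
suff PhiB : bijective Phi by apply: (eq_bij PhiB) => f; rewrite PhiE.
apply: lfun_bijective (dim_dual _).
apply/eqP/vspaceP => phi; rewrite memv_ker memv0; apply/eqP/eqP; last first.
  by move->; rewrite linear0.
move=> phi0.
pose ph v f g : k := phi (e (v, f) g).
(* The coordinate of [Phi phi] at e((h, n); k0). *)
have coef h n k0 : \sum_f (beta f n)^-2 *
    ph (theta f * h * k0 * h^-1)%g f (h * (theta n)^-1)%g = 0.
  have: coord (h, n) k0 (Phi phi) = 0 by rewrite phi0 linear0.
  rewrite PhiE /M /conjM !lfun_sec {1}/sec.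
  pose a v f : k := (beta f n)^-2 * ph v f (h * (theta n)^-1)%g.
  rewrite (eq_bigr (fun o : (gT * fT) * (gT * fT) => (o.2 == (h, n))%:R *
     ((o.1.1 == theta o.1.2 * h * k0 * h^-1)%g%:R * a o.1.1 o.1.2))); last first.
    move=> [[v f] o2] _ /=; rewrite /e2 tliftE; last bil.
    rewrite linearZ /= coordE; case: eqP => [->|_]; last first.
      by rewrite mul0r !scaler0.
    rewrite mul1r /a /= /ph -!mulgA -[RHS]mulrC -mulrA; congr (_ * (_ * _%:R)).
    rewrite -(inj_eq (mulgI h)) mulKVg -(inj_eq (mulgI (theta f))) mulKVg.
    by rewrite -(inj_eq (mulIg h^-1)%g) mulgK -!mulgA.
  rewrite -(pair_bigA _ (fun o1 o2 => (o2 == (h, n))%:R *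
     ((o1.1 == theta o1.2 * h * k0 * h^-1)%g%:R * a o1.1 o1.2))) exchange_big /=.
  rewrite (bigD1 (h, n)) //= [X in _ + X]big1 ?addr0; last first.
    by move=> o /negPf oN; rewrite big1 // => i _; rewrite oN mul0r.
  under eq_bigr => i _ do rewrite eqxx mul1r.
  rewrite -(pair_bigA _ (fun v f =>
     (v == theta f * h * k0 * h^-1)%g%:R * a v f)) exchange_big /= => E.
  rewrite -[RHS]E; apply: eq_bigr => f _.
  rewrite (bigD1 (theta f * h * k0 * h^-1)%g) //= eqxx mul1r big1 ?addr0 //.
  by move=> v /negPf->; rewrite mul0r.
apply/lfunP => y; rewrite zero_lfunE.
have lin0 : linear (fun _ : V => 0 : k^o) by move=> a u v; rewrite scaler0 addr0.
apply: (spans_eq (bm_spans bm) _ lin0) => [|[[v0 f0] g]]; first by lin.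
have betaV := betaV betaM betaC beta1.
have: \sum_n beta f0 n ^+ 2 * (\sum_f (beta f n)^-2 *
    ph (theta f * (theta f0)^-1 * v0)%g f g) = 0.
  rewrite big1 // => n _.
  have := coef (g * theta n)%g n
     ((g * theta n)^-1 * (theta f0)^-1 * v0 * (g * theta n))%g.
  rewrite mulgK => E; apply: etrans (mulr0 (beta f0 n ^+ 2)).
  congr (_ * _); rewrite -[RHS]E; apply: eq_bigr => f _.
  by congr (_ * ph _ _ _); grp.
under eq_bigr => n _ do rewrite mulr_sumr.
rewrite exchange_big /= (bigD1 f0) //= [X in _ + X]big1 ?addr0; last first.
  move=> f fN; under eq_bigr => n _ do rewrite mulrA -exprVn -betaV -exprMn -betaM.
  rewrite -mulr_suml beta2_orth; case: eqP => [E|]; last by rewrite !mul0r.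
  by case/eqP: fN; rewrite -(mulgKV f f0) E mul1g.
under eq_bigr => n _ do rewrite mulrA -exprVn -betaV -exprMn -betaM.
rewrite -mulr_suml beta2_orth mulgV eqxx mul1r mulgV mul1g => /eqP.
by rewrite mulf_eq0 (negPf fT_neq0) /= => /eqP.
Qed.

End Factorizable.

(** * Quotients by the kernel of an idempotent Hopf endomorphism *)

Section Quotients.
Context {k : fieldType}.

Context {V : vectType k} (H : hopf_ops V) (rho : 'End(V)).
Local Notation I := (lker rho).
Local Notation pi := (quot_proj I).
Local Notation K := (quot_hopf I H).

Lemma quot_proj_eq x y : (pi x == pi y) = (rho x == rho y).
Proof.
rewrite -subr_eq0 -linearB -memv_ker lker_quot_proj memv_ker linearB.
by rewrite subr_eq0.
Qed.

Lemma rho_repr x : rho (quot_repr I (pi x)) = rho x.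
Proof. by apply/eqP; rewrite -quot_proj_eq quot_projK. Qed.

Hypothesis rho_id : forall x, rho (rho x) = rho x.
Hypothesis rhoM : forall x y, rho (hprod H x y) = hprod H (rho x) (rho y).
Hypothesis rho_comul : forall x, tmap rho rho (hcomul H x) = hcomul H (rho x).
Hypothesis rho_counit : forall x, hcounit H (rho x) = hcounit H x.
Hypothesis rho_anti : forall x, rho (hanti H x) = hanti H (rho x).

Lemma quot_proj_rho x : pi (rho x) = pi x.
Proof. by apply/eqP; rewrite quot_proj_eq rho_id. Qed.

(** Two vectors have the same class exactly when [rho] identifies them, so that
    compatibility of the operations with the quotient map can be tested after
    applying [rho]. *)
Lemma quot_hopf_morphism : hopf_morphism H K pi.
Proof.
split=> //.
- move=> x y; apply/esym/(etrans (comp_lfun3 _ _ _ _)); rewrite tmapE; apply/eqP.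
  by rewrite quot_proj_eq -/(hprod H _ _) !rhoM !rho_repr.
- move=> x; apply: (etrans (comp_lfun3 _ _ _ _)).
  have pirho : (pi \o rho)%VF = pi.
    by apply/lfunP => y; rewrite comp_lfunE quot_proj_rho.
  have pirho2 z : tmap pi pi z = tmap pi pi (tmap rho rho z).
    by rewrite tmap_comp pirho.
  apply: (etrans (pirho2 _)); rewrite rho_comul rho_repr.
  by apply/esym/(etrans (pirho2 _)); rewrite rho_comul.
- by move=> x; rewrite comp_lfunE -[LHS]rho_counit rho_repr rho_counit.
- move=> x; apply: (etrans (comp_lfun3 _ _ _ _)); apply/eqP.
  by rewrite quot_proj_eq !rho_anti rho_repr.
Qed.

End Quotients.

(** * Splitting off the central group-like elements *)

Section CentralQuotient.
Context {k : fieldType} {gT fT : finGroupType} (theta : fT -> gT).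
Context (beta : fT -> fT -> k).
Hypothesis betaM : forall f f' n, beta (f * f')%g n = beta f n * beta f' n.
Hypothesis betaC : forall f n, beta f n = beta n f.
Hypothesis beta1 : forall f, beta f 1%g = 1.

(** The second component of an arrow records the power of the central group-like
    element by which a basis vector differs from one in the bismash product of
    [gT * fT] with [gT]. *)
Definition double_rr (o : gT * fT) (a : gT * fT) := conj_rr theta o a.1.
Definition double_ll (o : gT * fT) (a : gT * fT) := (conj_ll theta o a.1, a.2).

Context {V : vectType k} (H : hopf_ops V) (E : gT * fT -> gT * fT -> V).
Hypothesis bmD : is_bismash H double_rr double_ll E.
Context (coord : gT * fT -> gT * fT -> 'Hom(V, k^o)).
Hypothesis coordE : forall o a o' a',
  coord o a (E o' a') = ((o' == o) && (a' == a))%:R.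

(** Multiplication of each basis vector by the power of the central group-like
    that removes the second component of its arrow; see
    [mul_central_split]. *)
Definition split_proj : 'End(V) := linfun (fun v : V =>
  \sum_(i : (gT * fT) * (gT * fT))
     (coord i.1 i.2 v : k) *: ((beta i.1.2 i.2.2)^-1 *: E i.1 (i.2.1, 1%g))).
Local Notation rho := split_proj.

Lemma split_projE o a : rho (E o a) = (beta o.2 a.2)^-1 *: E o (a.1, 1%g).
Proof.
rewrite /split_proj linfunE; last by lin.
rewrite (bigD1 (o, a)) //= coordE !eqxx scale1r big1 ?addr0 //.
move=> [o' a']; rewrite /= xpair_eqE coordE [o' == o]eq_sym [a' == a]eq_sym.
by move=> /negPf ->; rewrite scale0r.
Qed.

Local Notation bN0 := (beta_neq0 betaM betaC beta1).

Let bVl := betaV betaM betaC beta1.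

Let bVr f n : beta f n^-1%g = (beta f n)^-1.
Proof. by rewrite betaC bVl betaC. Qed.

Lemma split_proj_id y : rho (rho y) = rho y.
Proof.
move: y; apply: (spans_eq (bm_spans bmD)); [by lin|by lin|move=> [o a] /=].
by rewrite split_projE linearZ /= split_projE /= beta1 invr1 scale1r.
Qed.

Lemma split_projM y z : rho (hprod H y z) = hprod H (rho y) (rho z).
Proof.
move: y; apply: (spans_eq (bm_spans bmD)); [by lin|by lin|move=> [o [h s]] /=].
move: z; apply: (spans_eq (bm_spans bmD)); [by lin|by lin|move=> [o' [h' s']] /=].
rewrite !split_projE hprodZl hprodZr !(bm_mul bmD) linearZ /= split_projE /=.
case: eqP => [->|_]; last by rewrite !scale0r !scaler0.
rewrite !scale1r scalerA !pairM mul1g /= -invfM /=.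
by rewrite [beta (double_rr _ _).2 _]/= mulrC (betaMr betaM betaC) mulrC.
Qed.

Lemma split_proj_comul y : tmap rho rho (hcomul H y) = hcomul H (rho y).
Proof.
move: y; apply: (spans_eq (bm_spans bmD)); [by lin|by lin|move=> [o [h s]] /=].
rewrite split_projE linearZ /= !(bm_comul bmD) lfun_sum scaler_sumr.
apply: eq_bigr => o2 _; rewrite tmapE !split_projE tensZl tensZr scalerA /=.
by rewrite -invfM -betaM; congr ((beta _ _)^-1 *: _); grp.
Qed.

Lemma split_proj_counit y : hcounit H (rho y) = hcounit H y.
Proof.
move: y; apply: (spans_eq (bm_spans bmD)); [by lin|by lin|move=> [o [h s]] /=].
rewrite split_projE linearZ /= !(bm_counit bmD).
case: eqP => [->|_]; last exact: mulr0.
by rewrite /= (beta1l betaC beta1) invr1 scale1r.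
Qed.

Lemma split_proj_anti y : rho (hanti H y) = hanti H (rho y).
Proof.
move: y; apply: (spans_eq (bm_spans bmD)); [by lin|by lin|move=> [o [h s]] /=].
rewrite (bm_anti bmD) !split_projE /=.
rewrite bVr bVl invrK linearZ /= (bm_anti bmD).
by congr (_ *: E _ _); rewrite /double_ll /= pairV invg1.
Qed.

Definition central_elt (s : fT) : V :=
  sec E (fun o => beta o.2 s) (fun=> (1%g, s)).

Lemma mul_central o a s :
  hprod H (E o a) (central_elt s) = beta o.2 s *: E o (a.1, a.2 * s)%g.
Proof.
rewrite -[E o a]sec_delta (sec1M bmD) /sec (bigD1 o) //= eqxx mul1r.
rewrite big1 ?addr0 => [|i /negPf->]; last by rewrite mul0r scale0r.
by case: a => h n; rewrite pairM mulg1.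
Qed.

Lemma central_eltM s s' :
  hprod H (central_elt s) (central_elt s') = central_elt (s * s')%g.
Proof.
rewrite (sec1M bmD); apply: eq_sec => o /=; last by rewrite pairM mul1g.
by rewrite (betaMr betaM betaC).
Qed.

Lemma central_elt1 : central_elt 1%g = hone H.
Proof. by rewrite (sec_one bmD); apply: eq_sec => o //=; rewrite beta1. Qed.

Lemma central_elt_pow s n : hpow H (central_elt s) n = central_elt (s ^+ n)%g.
Proof.
elim: n => [|n IHn]; first by rewrite central_elt1.
by rewrite /hpow iterS -/(hpow H _ n) IHn central_eltM expgS.
Qed.

Lemma central_elt_counit s : hcounit H (central_elt s) = 1.
Proof. by rewrite (sec_counit bmD) (beta1l betaC beta1). Qed.

Lemma split_proj_mul_central y s : rho (hprod H y (central_elt s)) = rho y.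
Proof.
move: y; apply: (spans_eq (bm_spans bmD)); [by lin|by lin|move=> [o [h n]] /=].
rewrite mul_central linearZ /= !split_projE /= scalerA (betaMr betaM betaC).
by rewrite invfM mulrCA mulfV ?bN0 // mulr1.
Qed.

Lemma mul_central_split o a :
  hprod H (E o a) (central_elt a.2^-1%g) = rho (E o a).
Proof.
by rewrite mul_central mulgV split_projE bVr.
Qed.

Context (x : fT).
Hypothesis x_gen : <[x]>%g = [set: fT].
Local Notation J := (left_ideal H (cyclic_algebra_plus H (central_elt x))).

Lemma dim_double : \dim {: V} = (#|gT| * #|fT| * (#|gT| * #|fT|))%N.
Proof.
rewrite (dim_dual_basis (coord := fun i => coord i.1 i.2) (bm_spans bmD)).
  by rewrite !card_prod.
by move=> [o a] [o' a'] /=; rewrite coordE xpair_eqE.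
Qed.

Lemma mem_left_ideal (B : {vspace V}) y z :
  z \in B -> hprod H y z \in left_ideal H B.
Proof.
move=> zB; rewrite (coord_vbasis (memvf y)) (coord_vbasis zB).
rewrite (linear_sumP ((hprod_bilin H).1 _)) rpred_sum // => i _; rewrite rpredZ //.
rewrite (linear_sumP ((hprod_bilin H).2 _)) rpred_sum // => j _; rewrite rpredZ //.
by apply/memv_span/allpairs_f; apply: mem_nth; rewrite size_tuple.
Qed.

Lemma central_elt_mem s : central_elt s \in cyclic_algebra H (central_elt x).
Proof.
have: s \in <[x]>%g by rewrite x_gen inE.
(* [cyclic_algebra] only contains powers with exponent below the dimension, so
   the order of [x] has to be compared with it. *)
case/cyclePmin => n; rewrite orderE x_gen cardsT => n_lt ->.
rewrite -central_elt_pow; apply/memv_span/map_f; rewrite mem_iota add0n /=.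
apply: leq_trans n_lt _; rewrite -[dim V]dimvf dim_double.
rewrite mulnA; apply: leq_pmull; rewrite !muln_gt0.
by rewrite !(introT card_gt0P) //; exists 1%g.
Qed.

(** One inclusion holds because [split_proj] does not see the factor [z_s].  For
    the other, a basis vector minus its image is the product of that vector with
    1 - z_s^-1. *)
Lemma lker_split_proj : lker rho = J.
Proof.
apply/eqP; rewrite eqEsubv; apply/andP; split; last first.
  apply/span_subvP => w /allpairsP[[y z] /= [_ zB ->]].
  have {zB} : z \in cyclic_algebra_plus H (central_elt x) by apply: vbasis_mem.
  rewrite memv_cap memv_ker => /andP[zC /eqP z0].
  rewrite memv_ker.
  have rhoyz : rho (hprod H y z) = (hcounit H z : k) *: rho y.
    move: z zC {z0}; apply: span_linear_eq; [by lin|by lin|].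
    move=> _ /mapP[n _ ->].
    by rewrite central_elt_pow split_proj_mul_central central_elt_counit scale1r.
  by rewrite rhoyz z0 scale0r.
apply/subvP => y; rewrite memv_ker => /eqP y0.
suff: y - rho y \in J by rewrite y0 subr0.
have {y0} [c ->] := bm_spans bmD y.
rewrite linear_sum -sumrB rpred_sum // => -[o a] _ /=.
rewrite linearZ -scalerBr rpredZ //= -mul_central_split.
have -> : E o a - hprod H (E o a) (central_elt a.2^-1%g) =
    hprod H (E o a) (-1 *: central_elt a.2^-1%g + central_elt 1%g).
  rewrite (hprod_bilin H).2 scaleN1r addrC (mul_central o a 1%g) beta1 scale1r mulg1.
  by rewrite -surjective_pairing.
apply: mem_left_ideal; rewrite memv_cap memv_ker.
rewrite rpredD ?rpredZ ?central_elt_mem //=.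
by rewrite linearP /= !central_elt_counit scaleN1r addNr.
Qed.

Local Notation K := (quot_hopf J H).
Local Notation pi := (quot_proj J).

Definition quot_basis (o : gT * fT) (g : gT) : quot J := pi (E o (g, 1%g)).

Lemma quot_projE o a : pi (E o a) = (beta o.2 a.2)^-1 *: quot_basis o a.1.
Proof.
rewrite /quot_basis -linearZ /= -split_projE; apply/esym.
by rewrite -lker_split_proj quot_proj_rho //; exact: split_proj_id.
Qed.

Lemma quot_morphism : hopf_morphism H K pi.
Proof.
rewrite -lker_split_proj; apply: quot_hopf_morphism.
- exact: split_proj_id.
- exact: split_projM.
- exact: split_proj_comul.
- exact: split_proj_counit.
- exact: split_proj_anti.
Qed.

Lemma quot_is_bismash :
  is_bismash K (conj_rr theta) (conj_ll theta) quot_basis.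
Proof.
have [piM pi1 piD pie piS] := quot_morphism.
split.
- move=> w; rewrite -(quot_projK w).
  have [c ->] := bm_spans bmD (quot_repr J w).
  exists (fun i => \sum_s c (i.1, (i.2, s)) * (beta i.1.2 s)^-1).
  rewrite (linear_sumP (linearP _)).
  transitivity (\sum_o \sum_a c (o, a) *: pi (E o a)).
    by rewrite pair_big; apply: eq_bigr => - [].
  transitivity (\sum_o \sum_g \sum_s
      (c (o, (g, s)) * (beta o.2 s)^-1) *: quot_basis o g).
    apply: eq_bigr => o _; rewrite pair_big; apply: eq_bigr => - [g s] _.
    by rewrite quot_projE scalerA.
  rewrite pair_big; apply: eq_bigr => i _.
  by rewrite scaler_suml.
- move=> o g o' g'; rewrite -piM (bm_mul bmD) linearZ /= pairM mulg1.
  by [].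
- by rewrite -pi1 (bm_one bmD) lfun_sum.
- move=> o g; rewrite piD (bm_comul bmD) lfun_sum; apply: eq_bigr => o2 _.
  by rewrite tmapE.
- by move=> o g; rewrite pie (bm_counit bmD).
- move=> o g; rewrite piS (bm_anti bmD); congr (pi (E _ _)).
  by rewrite /double_ll pairV invg1.
Qed.

Definition quot_coord (o : gT * fT) (g : gT) : 'Hom(quot J, k^o) :=
  (coord o (g, 1%g) \o rho \o quot_repr J)%VF.

Lemma quot_coordE o g o' g' :
  quot_coord o g (quot_basis o' g') = ((o' == o) && (g' == g))%:R.
Proof.
rewrite comp_lfun3 /quot_basis -lker_split_proj rho_repr split_projE /=.
by rewrite beta1 invr1 scale1r coordE xpair_eqE eqxx andbT.
Qed.

Lemma dim_quot : \dim {: quot J} = (#|gT| * #|fT| * #|gT|)%N.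
Proof.
rewrite (dim_dual_basis (coord := fun i => quot_coord i.1 i.2)
  (bm_spans quot_is_bismash)); first by rewrite !card_prod.
by move=> [o a] [o' a'] /=; rewrite quot_coordE xpair_eqE.
Qed.

(** The standard R-matrix of the double in the new coordinates; see
    [double_RE]. *)
Definition doubleR : tensor V V :=
  \sum_(o1 : gT * fT) \sum_(o2 : gT * fT)
    tens (E o1 ((theta o2.2)^-1, o2.2)%g) (E o2 (o1.1, 1%g)).

Lemma quot_doubleR : tmap pi pi doubleR = conjR theta beta quot_basis.
Proof.
rewrite lfun_sum; under eq_bigr => o1 _ do rewrite lfun_sum.
rewrite pair_big; apply: eq_bigr => - [o1 o2] _ /=.
by rewrite tmapE !quot_projE tensZl tensZr scalerA /= beta1 invr1 mulr1.
Qed.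

End CentralQuotient.

(** * The Drinfeld double of the smash product *)

Section SmashDouble.
Context {k : fieldType} {gT fT : finGroupType}.
Context (act : groupAction [set: fT] [set: gT]) (theta : fT -> gT).
Hypothesis fC : forall f n : fT, (f * n = n * f)%g.
Hypothesis thetaM : forall f n, theta (f * n)%g = (theta f * theta n)%g.
Hypothesis actE : forall g f, act g f = (theta f * g * (theta f)^-1)%g.

Local Notation H := (smash_hopf k act).
Local Notation sm := (smash k gT fT).
Local Notation dsm := 'Hom(sm, k^o).

Let thetaC f n : commute (theta f) (theta n).
Proof. by rewrite /commute -!thetaM fC. Qed.

Lemma ebasE g f i : (ebas g f : sm) i = (i == (g, f))%:R.
Proof. by rewrite ffunE. Qed.

Lemma smash_sum (u : sm) : u = \sum_i u i *: ebas i.1 i.2.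
Proof.
apply/ffunP => j; rewrite sum_ffunE (bigD1 j) //= big1 ?addr0.
  by rewrite !ffunE -surjective_pairing eqxx -[LHS]mulr1.
move=> i iN; rewrite !ffunE -surjective_pairing eq_sym (negPf iN).
exact: mulr0.
Qed.

Lemma elinE (U : vectType k) (phi : gT -> fT -> U) g f :
  elin phi (ebas g f) = phi g f.
Proof.
rewrite /elin linfunE; last by lin.
rewrite pair_big (bigD1 (g, f)) //= ebasE eqxx scale1r big1 ?addr0 //.
by move=> [g' f'] /= /negPf N; rewrite ebasE N scale0r.
Qed.

Lemma lin_elin (T U : vectType k) (phi : T -> gT -> fT -> U) u :
  (forall g f, linear (fun t => phi t g f)) ->
  linear (fun t => elin (phi t) u).
Proof.
move=> phiL a s t; rewrite /elin !linfunE; [|by lin|by lin|by lin].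
rewrite scaler_sumr -big_split; apply: eq_bigr => g _ /=.
rewrite scaler_sumr -big_split; apply: eq_bigr => f _ /=.
by rewrite phiL scalerDr !scalerA mulrC.
Qed.


Ltac smash_lin :=
  unfold hprod, dact, double_prod, comp; cbn [hmul smash_hopf dual_hopf cop_hopf];
  repeat (intros; first [progress cbv beta | apply: lin_elin => ? ? | lin_step]).
Ltac smash_bil := split=> ?; smash_lin.

Lemma smash_mul g f g' f' :
  hprod H (ebas g f) (ebas g' f') =
  (g' == theta f * g * (theta f)^-1)%g%:R *: ebas g (f * f')%g.
Proof.
rewrite /hprod /= tliftE; last smash_bil.
rewrite !elinE actE eq_sym; case: eqP => _; first by rewrite scale1r.
by rewrite scale0r.
Qed.

Lemma smash_comul g f :
  hcomul H (ebas g f) = \sum_h tens (ebas (g * h^-1)%g f) (ebas h f).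
Proof.
rewrite /= elinE.
rewrite -(pair_big_dep xpredT (fun z1 z2 => z1 * z2 == g)%g
  (fun z1 z2 => tens (ebas z1 f) (ebas z2 f))) (exchange_big_dep xpredT) //=.
apply: eq_bigr => h _; rewrite (big_pred1 (g * h^-1)%g) // => z.
by rewrite -(inj_eq (mulIg h^-1)%g) mulgK.
Qed.

Lemma smash_counit g f : hcounit H (ebas g f) = (g == 1%g)%:R.
Proof. by rewrite /= elinE. Qed.

Lemma smash_anti g f :
  hanti H (ebas g f) = ebas (theta f * g^-1 * (theta f)^-1)%g f^-1%g.
Proof. by rewrite /= elinE actE; congr (ebas _ _); grp. Qed.

Lemma smash_spans : spans (fun i : gT * fT => ebas i.1 i.2 : sm).
Proof. by move=> u; exists u; exact: smash_sum. Qed.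

Lemma smash_antiK : (hanti H \o hanti H)%VF = \1%VF.
Proof.
apply/lfunP; apply: (spans_eq smash_spans); [by lin|by lin|move=> [g f]].
rewrite comp_lfunE !smash_anti id_lfunE (thetaV thetaM) /=; congr (ebas _ _); grp => //.
Qed.

Lemma smash_antiV : (hanti H)^-1%VF = hanti H.
Proof. exact/involutive_lfunV/smash_antiK. Qed.

Definition dbas (g : gT) (f : fT) : dsm := linfun (fun u : sm => u (g, f)).

Lemma dbasE g f u : dbas g f u = u (g, f).
Proof. by rewrite /dbas linfunE //; lin. Qed.

Lemma dbas_ebas g f g' f' : dbas g f (ebas g' f') = ((g == g') && (f == f'))%:R.
Proof. by rewrite dbasE ebasE xpair_eqE. Qed.

Lemma dual_sum (phi : dsm) :
  phi = \sum_i (phi (ebas i.1 i.2) : k) *: dbas i.1 i.2.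
Proof.
apply/lfunP => u; rewrite {1}[u]smash_sum (linear_sumP (linearP _)).
rewrite sum_lfunE; apply: eq_bigr => - [g f] _.
by rewrite scale_lfunE dbasE /=; exact: mulrC.
Qed.

Lemma dual_eq (phi psi : dsm) :
  (forall g f, phi (ebas g f) = psi (ebas g f)) -> phi = psi.
Proof.
move=> E; apply/lfunP; apply: (spans_eq smash_spans); [by lin|by lin|].
by move=> [g f]; exact: E.
Qed.

Lemma dual_spans : spans (fun i : gT * fT => dbas i.1 i.2).
Proof. by move=> phi; exists (fun i => phi (ebas i.1 i.2)); exact: dual_sum. Qed.

(** The canonical element of V (x) V^* does not depend on the basis. *)
Lemma canonical_elt (U : vectType k) (B : sm -> dsm -> U) : bilin B ->
  \sum_i B (bvec i) (dvec i) = \sum_i B (ebas i.1 i.2) (dbas i.1 i.2).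
Proof.
move=> [Bl Br].
have dvecE i u : dvec i u = v2r u 0 i.
  by rewrite /dvec linfunE // => a v w; rewrite linearP !mxE.
transitivity (\sum_i \sum_j (dvec i (ebas j.1 j.2 : sm) : k) *:
    B (bvec i) (dbas j.1 j.2)).
  by apply: eq_bigr => i _; rewrite {1}[dvec i]dual_sum (linear_sumP (Br _)).
rewrite exchange_big; apply: eq_bigr => j _.
rewrite {2}[ebas _ _]bvec_sum (linear_sumP (Bl _)).
by apply: eq_bigr => i _; rewrite dvecE.
Qed.

Local Notation dH := (dual_hopf H).

Lemma dual_mulE (phi psi : dsm) u :
  hprod dH phi psi u = tlift (fun a b => phi a * psi b : k^o) (hcomul H u).
Proof.
rewrite /hprod [hmul dH]/= tliftE; last smash_bil.
by rewrite linfunE //; smash_lin.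
Qed.

Lemma dual_mul g f g' f' :
  hprod dH (dbas g f) (dbas g' f') = (f' == f)%:R *: dbas (g * g')%g f.
Proof.
apply: dual_eq => h s; rewrite dual_mulE smash_comul lfun_sum.
rewrite scale_lfunE dbas_ebas.
transitivity (\sum_i ((f == s) && (f' == s) && (g * g' == h)%g)%:R * (i == g')%:R : k).
  apply: eq_bigr => i _; rewrite tliftE; last smash_bil.
  rewrite !dbas_ebas -!natrM !mulnb eq_sym [g' == i]eq_sym; congr (_ %:R).
  case: (i =P g') => [->|_]; last by rewrite !andbF.
  rewrite -(inj_eq (mulIg g')) mulgKV eq_sym.
  by case: (_ == h); case: (f == s); case: (f' == s).
rewrite -mulr_sumr (bigD1 g') //= eqxx big1 ?addr0 ?mulr1 => [|i /negPf-> //].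
rewrite -[RHS]natrM mulnb; congr (_ %:R).
rewrite [f' == f]eq_sym; case: (f =P s) => [->|_]; last by rewrite !andbF.
by rewrite andbT /= [s == f']eq_sym.
Qed.

Lemma dual_unit : hone dH = \sum_f dbas 1%g f.
Proof.
apply: dual_eq => g s; rewrite sum_lfunE [hone dH]/= smash_counit.
rewrite (bigD1 s) //= dbas_ebas eqxx andbT big1 ?addr0 1?eq_sym // => f /negPf fN.
by rewrite dbas_ebas fN andbF.
Qed.

Lemma dual_unitM phi : hprod dH (hone dH) phi = phi.
Proof.
move: phi; apply: (spans_eq dual_spans); [by smash_lin|by []|move=> [g f]; cbn [fst snd]].
rewrite dual_unit (lin_sum1 ((hprod_bilin dH).1 _)).
rewrite (bigD1 f) //= dual_mul eqxx scale1r mul1g big1 ?addr0 // => i /negPf iN.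
by rewrite dual_mul eq_sym iN scale0r.
Qed.

Lemma smash_one_mul u : hprod H u (hone H) = u.
Proof.
move: u; apply: (spans_eq smash_spans); [by smash_lin|by []|move=> [g f]; cbn [fst snd]].
rewrite [hone H]/= (lin_sum1 ((hprod_bilin H).2 _)).
rewrite (bigD1 (theta f * g * (theta f)^-1)%g) //= smash_mul eqxx scale1r mulg1.
by rewrite big1 ?addr0 // => i /negPf iN; rewrite smash_mul iN scale0r.
Qed.

Lemma dual_comul g f :
  hcomul dH (dbas g f) = \sum_n
    tens (dbas g n) (dbas (theta n * g * (theta n)^-1)%g (n^-1 * f)%g).
Proof.
rewrite [hcomul dH]/= linfunE; last by smash_lin.
rewrite (canonical_elt (B := fun a da => \sum_j
  (dbas g f (hprod H a (bvec j)) : k) *: tens da (dvec j))); last by smash_bil.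
pose F h n : tensor dsm dsm := \sum_j ((g == h) && (f == n * j.2)%g)%:R *:
  ((j.1 == theta n * h * (theta n)^-1)%g%:R *: tens (dbas h n) (dbas j.1 j.2)).
transitivity (\sum_i F i.1 i.2).
  apply: eq_bigr => - [h n] _ /=; rewrite (canonical_elt (B := fun b db =>
    (dbas g f (hprod H (ebas h n) b) : k) *: tens (dbas h n) db)); last by smash_bil.
  apply: eq_bigr => - [h' n'] _ /=.
  rewrite smash_mul linearZ /= dbas_ebas [RHS]scalerA; congr (_ *: _).
  exact: mulrC.
rewrite -(pair_bigA _ F) exchange_big; apply: eq_bigr => n _ /=.
rewrite (bigD1 g) //= [X in _ + X]big1 ?addr0; last first.
  move=> h /negPf hN; rewrite /F big1 // => j _.
  by rewrite eq_sym hN scale0r.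
transitivity (\sum_j 1 *: ((j == ((theta n * g * (theta n)^-1), (n^-1 * f)))%g%:R *:
    tens (dbas g n) (dbas j.1 j.2))); last by rewrite (sum_delta (fun=> 1)) scale1r.
apply: eq_bigr => - [h m] _; rewrite eqxx scale1r scalerA -natrM mulnb xpair_eqE /=.
rewrite -[m == _](inj_eq (mulgI n)) mulKVg [f == _]eq_sym.
by case: (h == _); case: (_ == f).
Qed.

Lemma dual_counit g f : hcounit dH (dbas g f) = (f == 1%g)%:R.
Proof.
rewrite [hcounit dH]/= linfunE; last by smash_lin.
rewrite lfun_sum (bigD1 g) //= dbas_ebas eqxx big1 ?addr0 //.
by move=> h /negPf hN; rewrite dbas_ebas eq_sym hN.
Qed.

Lemma dual_anti g f :
  hanti dH (dbas g f) = dbas (theta f * g^-1 * (theta f)^-1)%g f^-1%g.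
Proof.
rewrite [hanti dH]/= linfunE; last by smash_lin.
apply: dual_eq => h n; rewrite comp_lfunE smash_anti !dbas_ebas.
rewrite -(inj_eq invg_inj f) invgK.
case: (f^-1%g =P n) => [<-|_]; last by rewrite !andbF.
rewrite !andbT; congr (nat_of_bool _)%:R; rewrite (thetaV thetaM).
by apply/eqP/eqP => [->|<-]; grp.
Qed.

Lemma dual_anti_cop : hanti (cop_hopf dH) = hanti dH.
Proof.
apply/involutive_lfunV/lfunP; apply: (spans_eq dual_spans); [by smash_lin|by smash_lin|].
move=> [g f]; cbn [fst snd].
rewrite comp_lfunE !dual_anti id_lfunE (thetaV thetaM) invgK.
by congr (dbas _ _); grp.
Qed.

Local Notation D := (drinfeld_double H).

Definition tbas (g : gT) (f : fT) (w : gT) (s : fT) : tensor dsm sm :=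
  tens (dbas g f) (ebas w s).

Lemma double_dact g f w s z r :
  dact H (ebas w s) (dbas g f) (ebas z r) =
  ((z == g) && (w == theta (f * s^-1) * g * (theta (f * s^-1))^-1)%g)%:R *:
  dbas (theta r * g * (theta r)^-1)%g (r^-1 * f * s^-1)%g.
Proof.
apply: dual_eq => h m; rewrite /dact linfunE; last by smash_lin.
rewrite scale_lfunE smash_mul hprodZl smash_mul !linearZ /= !dbas_ebas.
rewrite -![_ *: _ : k^o]/(_ * _) -!natrM !mulnb; congr (nat_of_bool _)%:R.
rewrite [z == g]eq_sym; case: (g =P z) => [<-|_]; last by rewrite !andbF.
rewrite /= [h == _]eq_sym [RHS]andbCA; congr (_ && _).
have -> : (r^-1 * f * s^-1 == m)%g = (f == r * m * s)%g.
  by rewrite -(inj_eq (mulgI r)) -(inj_eq (mulIg s)) !mulgA mulgV mul1g mulgKV.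
by case: (f =P (r * m * s)%g) => [->|_]; rewrite ?andbF ?andbT ?mulgK.
Qed.

(** In the double sum over the threefold coproduct of [ebas w s] the outer
    factors are determined by [g] and [f], and a single term remains. *)
Lemma double_prodE phi w s g f l :
  double_prod H phi (ebas w s) (dbas g f) l =
  tens (hprod dH phi (dbas (theta s^-1 * g * (theta s^-1)^-1) f)%g)
    (hprod H (ebas ((theta (f * s^-1) * g * (theta (f * s^-1))^-1)^-1 * w *
       (theta s^-1 * g * (theta s^-1)^-1))%g s) l).
Proof.
rewrite /double_prod smash_comul lfun_sum lfun_sum.
set gr := (theta s^-1 * _ * _)%g; set gl := (theta (f * s^-1) * _ * _)%g.
transitivity (\sum_h3 1 *: ((h3 == gr^-1)%g%:R *: (\sum_h2 1 *:
   ((h2 == gl^-1 * (w * h3^-1))%g%:R *: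
   (tens (hprod dH phi (dbas gr f)) (hprod H (ebas h2 s) l) : tensor dsm sm))))).
  apply: eq_bigr => h3 _; rewrite scale1r tmapE id_lfunE smash_comul.
  rewrite tliftE; last by smash_bil.
  rewrite lfun_sum scaler_sumr; apply: eq_bigr => h2 _.
  rewrite tliftE; last by smash_bil.
  rewrite smash_antiV smash_anti double_dact scale1r scalerA -natrM mulnb.
  rewrite -[hprod (cop_hopf _) _ _]/(hprod dH _ _) hprodZr tensZl.
  rewrite invgK [(s * f)%g]fC mulgK.
  congr ((nat_of_bool (_ && _))%:R *: _); apply/eqP/eqP => E.
  - by rewrite /gr -E (thetaV thetaM); grp.
  - by rewrite E /gr (thetaV thetaM); grp.
  - by rewrite /gl -E; grp.
  - by rewrite E -/gl; grp.
rewrite (sum_delta (fun=> 1)) (sum_delta (fun=> 1)) !scale1r invgK mulgA.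
by [].
Qed.

Lemma tbasM g f w s g' f' w' s' :
  hprod D (tbas g f w s) (tbas g' f' w' s') =
  ((f' == f) && (w' == theta s * ((theta (f' * s^-1) * g' *
      (theta (f' * s^-1))^-1)^-1 * w * (theta s^-1 * g' * (theta s^-1)^-1)) *
      (theta s)^-1)%g)%:R *:
  tbas (g * (theta s^-1 * g' * (theta s^-1)^-1))%g f
     ((theta (f' * s^-1) * g' * (theta (f' * s^-1))^-1)^-1 * w *
      (theta s^-1 * g' * (theta s^-1)^-1))%g (s * s')%g.
Proof.
rewrite /hprod [hmul D]/= /double_mul /tbas tliftE; last by smash_bil.
rewrite tliftE; last by smash_bil.
rewrite tliftE; last by smash_bil.
rewrite double_prodE dual_mul smash_mul tensZl tensZr scalerA -natrM mulnb.
by [].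
Qed.

Lemma tbas_one : hone D = \sum_f \sum_w tbas 1%g f w 1%g.
Proof.
have -> : hone D = tens (hone dH) (\sum_w ebas w 1%g : sm) by [].
rewrite dual_unit (lin_sum1 (tens_linl _)).
by apply: eq_bigr => f _; rewrite (lin_sum1 (tens_linr _)).
Qed.

Lemma tbas_comul g f w s :
  hcomul D (tbas g f w s) = \sum_n \sum_h
    tens (tbas (theta n * g * (theta n)^-1)%g (n^-1 * f)%g (w * h^-1)%g s)
         (tbas g n h s).
Proof.
rewrite [hcomul D]/= /tbas tliftE; last by smash_bil.
rewrite comp_lfunE -[linfun _]/(hcomul dH) dual_comul !lfun_sum.
apply: eq_bigr => n _; rewrite tflipE tliftE; last by smash_bil.
rewrite -[elin _]/(hcomul H) smash_comul lfun_sum; apply: eq_bigr => h _.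
by rewrite tliftE //; smash_bil.
Qed.

Lemma tbas_counit g f w s :
  hcounit D (tbas g f w s) = ((f == 1%g) && (w == 1%g))%:R.
Proof.
rewrite [hcounit D]/= /tbas tliftE; last by smash_bil.
rewrite -[linfun _]/(hcounit dH) -[elin _]/(hcounit H).
by rewrite dual_counit smash_counit -natrM mulnb.
Qed.

Lemma tbas_anti g f w s :
  hanti D (tbas g f w s) =
  tbas (theta (f * s) * g^-1 * (theta (f * s))^-1)%g f^-1%g
     ((theta s * g^-1 * (theta s)^-1)^-1 * (theta s * w^-1 * (theta s)^-1) *
      (theta (f * s) * g^-1 * (theta (f * s))^-1))%g s^-1%g.
Proof.
have -> : hanti D = tlift (fun phi u => double_mul H (tens
    (tens (hone dH) (hanti H u)) (tens (hanti (cop_hopf dH) phi) (hone H)))) by [].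
rewrite /tbas tliftE; last by smash_bil.
rewrite dual_anti_cop dual_anti smash_anti /double_mul.
rewrite tliftE; last by smash_bil.
rewrite tliftE; last by smash_bil.
rewrite tliftE; last by smash_bil.
rewrite double_prodE dual_unitM smash_one_mul.
rewrite !(thetaM, thetaV thetaM) invgK /tbas.
have sf := thetaC s f.
by congr (tens (dbas _ _) (ebas _ _)); grpcomm sf.
Qed.

(** The object [o] is the left unit of the vector in the groupoid algebra
    underlying the double, and the factor [theta a.2] in the group element makes
    the action of an arrow on objects depend on [a.1] only. *)
Definition double_basis (o a : gT * fT) : tensor dsm sm :=
  let g := (a.1 * theta a.2)%g in tbas g o.2 (conj_rr theta o g).1 a.2.
Local Notation dE := double_basis.

Lemma double_basisE v f h s :
  dE (v, f) (h, s) = tbas (h * theta s) f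
    ((theta f * h * theta s * (theta f)^-1)^-1 * v * h * theta s) s.
Proof. by rewrite /dE /conj_rr /conj_ll /= !mulgA. Qed.

Lemma tbas_double_basis g f w s :
  tbas g f w s =
  dE (theta f * g * (theta f)^-1 * w * g^-1, f)%g (g * (theta s)^-1, s)%g.
Proof.
rewrite double_basisE; congr tbas; first by grp.
by grp.
Qed.

Lemma double_spans : spans (fun i : (gT * fT) * (gT * fT) => dE i.1 i.2).
Proof.
apply: (spans_reindex (spans_tens dual_spans smash_spans)
  (h := fun i : (gT * fT) * (gT * fT) => let: ((g, f), (w, s)) := i in
    ((theta f * g * (theta f)^-1 * w * g^-1, f), (g * (theta s)^-1, s))%g)).
by move=> [[g f] [w s]]; exact: tbas_double_basis.
Qed.

Definition double_coord (o a : gT * fT) : 'Hom(tensor dsm sm, k^o) :=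
  let g := (a.1 * theta a.2)%g in
  tlift (fun (phi : dsm) (u : sm) =>
    phi (ebas g o.2) * u ((conj_rr theta o g).1, a.2) : k^o).

Lemma double_coordE o a o' a' :
  double_coord o a (dE o' a') = ((o' == o) && (a' == a))%:R.
Proof.
case: o a o' a' => [v f] [h s] [v' f'] [h' s'].
rewrite /double_coord /dE /tbas tliftE; last by smash_bil.
rewrite dbas_ebas ebasE -natrM mulnb; congr (nat_of_bool _)%:R.
rewrite /conj_rr /conj_ll /= !xpair_eqE [s == s']eq_sym.
case: (s' =P s) => [->|_]; last by rewrite !andbF.
rewrite [f' == f]eq_sym !andbT (inj_eq (mulIg _)) [h' == h]eq_sym.
case: (f =P f') => [->|_]; last by rewrite !andbF.
rewrite !andbT [RHS]andbC; case: (h =P h') => [->|_] //=.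
by rewrite (inj_eq (mulIg _)) (inj_eq (mulgI _)) eq_sym.
Qed.

Local Notation drr := (double_rr theta).
Local Notation dll := (double_ll theta).

Lemma double_bismash : is_bismash D drr dll dE.
Proof.
split.
- exact: double_spans.
- move=> [v f] [h s] [v' f'] [h' s'].
  rewrite !double_basisE tbasM /double_rr /conj_rr /conj_ll /= xpair_eqE andbC.
  case: (f' =P f) => [{f'}->|_]; last by rewrite !andbF !scale0r.
  have fs := thetaC s f; have fs' := thetaC s' f; have ss' := thetaC s' s.
  rewrite !andbT !(thetaM, thetaV thetaM).
  set w := (theta s * _ * _)%g.
  have {w}-> : w = ((theta f * h' * theta s' * (theta f)^-1)^-1 *
      ((theta f * h * (theta f)^-1)^-1 * v * h) * h' * theta s')%g.
    by rewrite /w; grpcomm3 fs fs' ss'.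
  rewrite !(inj_eq (mulIg _)) (inj_eq (mulgI _)).
  congr (_ *: _).
  by congr tbas; grpcomm3 fs fs' ss'.
- rewrite tbas_one.
  transitivity (\sum_f \sum_v dE (v, f) 1%g); last first.
    by rewrite exchange_big pair_big; apply: eq_bigr => - [].
  apply: eq_bigr => f _; apply: eq_bigr => v _.
  by rewrite (@pair1 gT fT) double_basisE (theta1 thetaM); congr tbas; grp.
- move=> [v f] [h s]; rewrite double_basisE tbas_comul.
  transitivity (\sum_n \sum_v2 tens
      (dE ((v, f) * (v2, n)^-1)%g (dll (v2, n) (h, s))) (dE (v2, n) (h, s))).
    apply: eq_bigr => n _; pose g := (h * theta s)%g.
    rewrite (reindex_inj (h := fun v2 =>
      ((theta n * g * (theta n)^-1)^-1 * v2 * g)%g)); last first.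
      by move=> v2 v2' /mulIg/mulgI.
    have fn := thetaC n f; have fs := thetaC s f; have ns := thetaC s n.
    apply: eq_bigr => v2 _; rewrite /g /double_ll /conj_ll pairV pairM.
    rewrite !double_basisE !(thetaM, thetaV thetaM) [(n^-1 * f)%g]fC.
    by congr (tens (tbas _ _ _ _) (tbas _ _ _ _)); grpcomm3 fn fs ns.
  by rewrite exchange_big pair_big; apply: eq_bigr => - [].
- move=> [v f] [h s]; rewrite double_basisE tbas_counit.
  rewrite (@pair1 gT fT) xpair_eqE andbC; congr (nat_of_bool _)%:R.
  case: (f =P 1%g) => [->|_]; last by rewrite !andbF.
  rewrite (theta1 thetaM) !andbT.
  rewrite -[LHS](inj_eq (mulgI (h * theta s)%g)).
  rewrite -[LHS](inj_eq (mulIg (h * theta s)^-1%g)).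
  by congr (_ == _); grp.
- move=> [v f] [h s]; rewrite double_basisE tbas_anti.
  have sf := thetaC s f.
  rewrite /double_ll pairV /double_rr /conj_rr /conj_ll /= pairV double_basisE.
  rewrite !(thetaM, thetaV thetaM).
  by congr tbas; grpcomm sf.
Qed.

Lemma double_RE : drinfeld_double_R H = doubleR theta dE.
Proof.
rewrite /drinfeld_double_R.
rewrite -[hone (cop_hopf _)]/(hone dH).
rewrite (canonical_elt (B := fun u phi =>
  tens (tens (hone dH) u) (tens phi (hone H)))); last by smash_bil.
have oneE : hone H = \sum_w ebas w 1%g by [].
move: (hone H) oneE (hone dH) dual_unit => oneH oneE oned onedE.
rewrite /doubleR -(pair_bigA _ (fun g n =>
  tens (tens oned (ebas g n : sm)) (tens (dbas g n) oneH))) /=.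
rewrite -(pair_bigA _ (fun g f => \sum_(o2 : gT * fT)
  tens (dE (g, f) ((theta o2.2)^-1, o2.2)%g) (dE o2 (g, 1%g)))) /=.
apply: eq_bigr => g _; rewrite exchange_big /=.
rewrite -(pair_bigA _ (fun v n => \sum_f
  tens (dE (g, f) ((theta n)^-1, n)%g) (dE (v, n) (g, 1%g)))) exchange_big /=.
apply: eq_bigr => n _; rewrite exchange_big /= onedE.
rewrite (lin_sum1 (tens_linl _)) (lin_sum1 (tens_linl _)); apply: eq_bigr => f _.
rewrite oneE !(lin_sum1 (tens_linr _)).
rewrite (reindex_inj (h := fun v => ((theta n * g * (theta n)^-1)^-1 * v * g)%g)).
  apply: eq_bigr => v _; rewrite !double_basisE (theta1 thetaM).
  by congr (tens (tbas _ _ _ _) (tbas _ _ _ _)); grp.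
by move=> v v' /mulIg/mulgI.
Qed.

End SmashDouble.

(** * The order of the presented group *)

Section GroupOrder.
Context (p q t : nat).
Hypotheses (p_prime : prime p) (q_prime : prime q).
Hypotheses (p_mod_q : (p = 1 %[mod q])%N) (tq_mod_p : (t ^ q = 1 %[mod p])%N).
Hypothesis t_mod_p : (t <> 1 %[mod p])%N.

(** The affine group over the field with [p] elements realises the
    presentation, so the presented group is not smaller than expected. *)
Lemma affine_model : exists (rT : finGroupType) (u v : rT),
  [/\ (u ^+ p = 1)%g, (v ^+ q = 1)%g, (v * u * v^-1 = u ^+ t)%g &
      #[u]%g = p /\ #[v]%g = q].
Proof.
have pgt1 := prime_gt1 p_prime; have qgt0 := prime_gt0 q_prime.
have FpE (m n : nat) : m = n %[mod p] -> m%:R = n%:R :> 'F_p.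
  by move=> mn; apply/val_inj; rewrite /= !val_Fp_nat.
have tq1 : t%:R ^+ q = 1 :> 'F_p by rewrite -natrX (FpE _ 1%N).
have tqV : t%:R * t%:R ^+ q.-1 = 1 :> 'F_p by rewrite -exprS prednK.
have transI : injective (fun z : 'F_p => z + 1) by exact: addIr.
have dilI : injective (fun z : 'F_p => z * t%:R ^+ q.-1).
  apply: (can_inj (g := fun z => z * t%:R)) => z.
  by rewrite -mulrA [_ * t%:R]mulrC tqV mulr1.
(* The dilation by t^-1 conjugates the translation by 1 to the translation by t,
   as permutations act on the right. *)
pose u := perm transI; pose v := perm dilI.
have uX n z : (u ^+ n)%g z = z + n%:R.
  elim: n z => [|n IHn] z; first by rewrite expg0 perm1 addr0.
  by rewrite expgSr permM IHn permE -addrA -natr1.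
have vX n z : (v ^+ n)%g z = z * (t%:R ^+ q.-1) ^+ n.
  elim: n z => [|n IHn] z; first by rewrite expg0 perm1 mulr1.
  by rewrite expgSr permM IHn permE -mulrA exprSr.
have up : (u ^+ p = 1)%g.
  apply/permP => z; rewrite uX perm1 (FpE p 0%N) ?addr0 //.
  by rewrite modnn mod0n.
have vq : (v ^+ q = 1)%g.
  by apply/permP => z; rewrite vX perm1 exprAC tq1 expr1n mulr1.
exists _, u, v; split=> //.
  apply: (mulIg v); rewrite mulgKV; apply/permP => z.
  by rewrite permM [RHS]permM uX !permE mulrDl tqV.
have u1 : #[u]%g != 1%N.
  rewrite order_eq1; apply/eqP => /permP/(_ 0).
  by rewrite permE perm1 add0r => /eqP; rewrite oner_eq0.
have v1 : #[v]%g != 1%N.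
  rewrite order_eq1; apply/eqP => /permP/(_ 1); rewrite permE perm1 mul1r => tq.
  move: tqV; rewrite tq mulr1 -[RHS]/(1%:R) => /(congr1 val) /=.
  rewrite val_Fp_nat // Fp_cast //.
split; first by apply/(prime_nt_dvdP p_prime u1); rewrite order_dvdn up.
by apply/(prime_nt_dvdP q_prime v1); rewrite order_dvdn vq.
Qed.

Lemma coprime_pq : coprime p q.
Proof.
rewrite prime_coprime // dvdn_prime2 //; apply/eqP => pq.
move: p_mod_q; rewrite pq modnn modn_small ?prime_gt1 //.
Qed.

Context (gT : finGroupType) (a b : gT).
Hypothesis G_pres : [set: gT] \isog
  Grp (a : b : (a ^+ p, b ^+ q, b * a * b^-1 = a ^+ t))%g.
Hypothesis G_gen : <<[set a; b]>>%g = [set: gT].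
Hypotheses (a_p : (a ^+ p = 1)%g) (b_q : (b ^+ q = 1)%g).
Hypothesis a_b : (b * a * b^-1 = a ^+ t)%g.

Lemma conj_expg (i : nat) : (b ^+ i * a * (b ^+ i)^-1 = a ^+ (t ^ i)%N)%g.
Proof.
elim: i => [|i IHi]; first by rewrite !expg0 mul1g invg1 mulg1 expn0 expg1.
have conjE (g h : gT) : (h * g * h^-1 = g ^ h^-1)%g.
  by rewrite conjgE invgK mulgA.
rewrite conjE in IHi; rewrite conjE expgS invMg conjgM IHi conjXg -conjE a_b.
by rewrite -expgM expnS.
Qed.

Lemma card_group_le : (#|gT| <= p * q)%N.
Proof.
have nab : <[b]>%g \subset 'N(<[a]>)%g.
  rewrite cycle_subG -groupV inE -cycleJ conjgE invgK mulgA a_b.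
  by rewrite cycle_subG mem_cycle.
have -> : #|gT| = #|(<[a]> * <[b]>)%g|.
  by rewrite -cardsT -G_gen -norm_joinEr // joing_idl joing_idr.
apply: leq_trans (_ : (#[a]%g * #[b]%g <= _)%N).
  by rewrite !orderE mul_cardG leq_pmulr // cardG_gt0.
by apply: leq_mul; apply: dvdn_leq; rewrite ?prime_gt0 // order_dvdn ?a_p ?b_q.
Qed.

Lemma card_group_ge : (p * q <= #|gT|)%N.
Proof.
have [rT [u [v [up vq vuv [ou ov]]]]] := affine_model.
have hom : (<[u]> <*> <[v]> \homg [set: gT])%g.
  rewrite G_pres; apply/existsP; exists (u, v).
  by rewrite /= !xpair_eqE up vq vuv !eqxx.
rewrite -cardsT; apply: leq_trans (dvdn_leq _ (card_homg hom)); last exact: cardG_gt0.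
apply: dvdn_leq; first exact: cardG_gt0.
rewrite Gauss_dvd ?coprime_pq //; apply/andP; split.
  by rewrite -ou orderE cardSg // joing_subl.
by rewrite -ov orderE cardSg // joing_subr.
Qed.

Lemma card_group : #|gT| = (p * q)%N.
Proof. by apply/eqP; rewrite eqn_leq card_group_le card_group_ge. Qed.

End GroupOrder.

(** * The character and the bicharacter *)

Section Character.
Context {k : fieldType} {gT fT : finGroupType}.
Context (act : groupAction [set: fT] [set: gT]) (theta : fT -> gT).
Hypothesis actE : forall g f, act g f = (theta f * g * (theta f)^-1)%g.
Local Notation H := (smash_hopf k act).

Lemma character_ebas (chi : 'Hom(smash k gT fT, k^o)) (x : fT) g n :
  is_character H chi ->
  chi (ebas g (x ^+ n)%g) =
  chi (ebas g 1%g) * chi (\sum_(h : gT) ebas h x) ^+ n.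
Proof.
case=> _ chiM; elim: n => [|n IHn]; first by rewrite expg0 expr0 mulr1.
rewrite exprSr mulrA -IHn -chiM (lin_sum1 ((hprod_bilin H).2 _)).
rewrite (bigD1 (theta (x ^+ n) * g * (theta (x ^+ n))^-1)%g) //=.
rewrite (smash_mul actE) eqxx scale1r big1 ?addr0 ?expgSr // => h /negPf hN.
by rewrite (smash_mul actE) hN scale0r.
Qed.

Lemma tens_character (beta : fT -> fT -> k) (x : fT) :
  tens (\sum_f beta f x *: dbas (theta x) f) (\sum_(g : gT) ebas g x)
  = central_elt beta (double_basis theta) x
    :> tensor 'Hom(smash k gT fT, k^o) (smash k gT fT).
Proof.
rewrite (linear_sumP (tens_linl _)) /central_elt /sec.
transitivity (\sum_(v : gT) \sum_f
    beta f x *: double_basis (k := k) theta (v, f) (1%g, x)).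
  rewrite exchange_big; apply: eq_bigr => f _; rewrite (lin_sum1 (tens_linr _)).
  rewrite (reindex_inj (h := fun v =>
    ((theta f * theta x * (theta f)^-1)^-1 * v * theta x)%g)).
    rewrite scaler_sumr; apply: eq_bigr => v _; rewrite double_basisE /tbas.
    by congr (_ *: tens (dbas _ _) (ebas _ _)); grp.
  by move=> v v' /mulIg/mulgI.
by rewrite pair_big; apply: eq_bigr => - [].
Qed.

End Character.

(** [L] is a discrete logarithm to the base [x]; it is only determined modulo
    [q], which is harmless in exponents of [omega] and of [b]. *)
Section DiscreteLog.
Context {k : fieldType} (q : nat) (q_prime : prime q) (q_odd : odd q).
Context {fT : finGroupType} (x : fT) (L : fT -> nat).
Hypothesis LE : forall f, f = (x ^+ L f)%g.
Hypothesis x_q : #[x]%g = q.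
Context (omega : k) (omega_q : q.-primitive_root omega).

Lemma dlogX n : L (x ^+ n)%g = n %[mod q].
Proof. by apply/eqP; rewrite -x_q -eq_expg_mod_order -LE. Qed.

Lemma dlogM f n : L (f * n)%g = L f + L n %[mod q].
Proof. by rewrite {1}[f]LE {1}[n]LE -expgD dlogX. Qed.

Definition bichar (f n : fT) : k := omega ^+ (L f * L n).

Lemma bicharC f n : bichar f n = bichar n f.
Proof. by rewrite /bichar mulnC. Qed.

Lemma bicharM f f' n : bichar (f * f')%g n = bichar f n * bichar f' n.
Proof.
rewrite /bichar -exprD -mulnDl; apply/eqP.
by rewrite (eq_prim_root_expr omega_q) -modnMml dlogM modnMml.
Qed.

Lemma bichar1 f : bichar f 1%g = 1.
Proof.
rewrite /bichar -(expr0 omega); apply/eqP; rewrite (eq_prim_root_expr omega_q).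
have L1 : L 1%g = 0 %[mod q] by rewrite -(expg0 x) dlogX.
by rewrite -modnMmr L1 mod0n muln0 mod0n.
Qed.

Lemma bichar_x f : bichar f x = omega ^+ L f.
Proof.
apply/eqP; rewrite (eq_prim_root_expr omega_q).
have L1 : L x = 1 %[mod q] by rewrite -(dlogX 1) expg1.
by rewrite -modnMmr L1 modnMmr muln1.
Qed.

(** Orthogonality of characters; as [q] is odd, the square of a nontrivial
    character of [F] is nontrivial. *)
Lemma bichar2_orth f : \sum_n bichar f n ^+ 2 = (f == 1%g)%:R * #|fT|%:R.
Proof.
case: eqP => [->|fN].
  rewrite mul1r -sumr_const; apply: eq_bigr => n _.
  by rewrite bicharC bichar1 expr1n.
(* Shifting the index of summation by [x] multiplies the sum by the square of
   beta(f, x), which differs from 1. *)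
rewrite mul0r; set S := \sum_n _.
have S0 : S * (1 - bichar f x ^+ 2) = 0.
  apply/eqP; rewrite mulrBr mulr1 subr_eq0; apply/eqP.
  rewrite {1}/S (reindex_inj (mulIg x)) mulr_suml; apply: eq_bigr => n _.
  by rewrite bicharC bicharM exprMn !(bicharC _ f).
move/eqP: S0; rewrite mulf_eq0 subr_eq0 => /orP[/eqP // | ].
rewrite bichar_x -exprM eq_sym -(expr0 omega) (eq_prim_root_expr omega_q) mod0n.
rewrite -/(dvdn q _) Euclid_dvdM // => /orP[qL | q2].
  case: fN; rewrite [f]LE; apply/eqP.
  by rewrite -order_dvdn x_q.
by have := q_odd; move: q2; rewrite dvdn_prime2 // => /eqP->.
Qed.

End DiscreteLog.

(** * The quotient of the double *)

Theorem proposition4p19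
    (k : closedFieldType) (k_char0 : [pchar k] =i pred0)
    (p q : nat) (p_prime : prime p) (q_prime : prime q)
    (p_odd : odd p) (q_odd : odd q) (p_mod_q : (p = 1 %[mod q])%N)
    (t : nat) (tq_mod_p : (t ^ q = 1 %[mod p])%N) (t_mod_p : (t <> 1 %[mod p])%N)
    (* G = < a, b | a^p = b^q = 1, b a b^-1 = a^t > *)
    (gT : finGroupType) (a b : gT)
    (G_pres : [set: gT] \isog
       Grp (a : b : (a ^+ p, b ^+ q, b * a * b^-1 = a ^+ t))%g)
    (G_gen : <<[set a; b]>>%g = [set: gT])
    (a_p : (a ^+ p = 1)%g) (b_q : (b ^+ q = 1)%g)
    (a_b : (b * a * b^-1 = a ^+ t)%g)
    (* F = < x | x^q = 1 > *)
    (fT : finGroupType) (x : fT)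
    (F_gen : <[x]>%g = [set: fT]) (x_q : #[x]%g = q)
    (act : groupAction [set: fT] [set: gT])
    (act_a : forall i : nat, act a (x ^+ i)%g = (a ^+ (t ^ i)%N)%g)
    (act_b : forall i : nat, act b (x ^+ i)%g = b)
    (omega : k) (omega_q : q.-primitive_root omega)
    (chi : 'Hom(smash k gT fT, k^o))
    (chi_char : is_character (smash_hopf k act) chi)
    (chi_e : forall g : gT, chi (ebas g 1%g) = (g == b)%:R)
    (chi_x : chi (\sum_(g : gT) ebas g x) = omega) :
  let D := drinfeld_double (smash_hopf k act) in
  let chix := tens chi (\sum_(g : gT) ebas g x) in
  let I := left_ideal D (cyclic_algebra_plus D chix) in
  let K := quot_hopf I D in
  let R := tmap (quot_proj I) (quot_proj I) (drinfeld_double_R (smash_hopf k act)) in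
  [/\ is_hopf K /\ hopf_morphism D K (quot_proj I),
      is_quasitriangular K R,
      is_factorizable K R,
      is_ribbon K R &
      \dim {: quot I} = (p ^ 2 * q ^ 3)%N].
Proof.
have fT_card : #|fT| = q by rewrite -cardsT -F_gen -orderE.
have [L LE] : exists L : fT -> nat, forall f, f = (x ^+ L f)%g.
  apply: (fin_all_exists (P := fun f n => f = (x ^+ n)%g)) => f.
  have /cycleP[i ->] : f \in <[x]>%g by rewrite F_gen inE.
  by exists i.
have fC (f n : fT) : (f * n = n * f)%g by rewrite [f]LE [n]LE -!expgD addnC.
pose theta f := (b ^+ L f)%g.
have thetaM f n : theta (f * n)%g = (theta f * theta n)%g.
  by rewrite /theta -expgD -(expg_mod _ b_q) (dlogM LE x_q) expg_mod.
have thetax : theta x = b.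
  by rewrite /theta -(expg_mod _ b_q) -[x]expg1 (dlogX LE x_q) expg_mod.
have actE g f : act g f = (theta f * g * (theta f)^-1)%g.
  (* Both sides are automorphisms of [G] and agree on [a] and [b]. *)
  have actb (h : gT) i : act h (x ^+ i)%g = (b ^+ i * h * (b ^+ i)^-1)%g.
    pose S := [set h : gT | act h (x ^+ i)%g == (b ^+ i * h * (b ^+ i)^-1)%g].
    have xD : (x ^+ i)%g \in [set: fT] by rewrite inE.
    have gS : group_set S.
      apply/group_setP; split=> [|u v]; rewrite !inE.
        by rewrite gact1 //; apply/eqP; grp.
      rewrite gactM ?inE // => /eqP-> /eqP->; apply/eqP; grp => //.
    have: <<[set a; b]>>%g \subset S.
      rewrite (gen_subG _ (Group gS)) /= subUset !sub1set !inE.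
      rewrite act_a act_b (conj_expg a_b) eqxx /=.
      by rewrite -expgSr expgS mulgK.
    by rewrite G_gen => /subsetP/(_ h (in_setT _)); rewrite inE => /eqP.
  by rewrite {1}[f]LE actb.
pose beta := bichar L omega.
have betaM := bicharM LE x_q omega_q : forall f f' n, beta _ _ = _.
have betaC := bicharC L omega : forall f n, beta f n = _.
have beta1 := bichar1 LE x_q omega_q : forall f, beta f _ = _.
have orth := bichar2_orth q_prime q_odd LE x_q omega_q.
have fT0 : #|fT|%:R != 0 :> k.
  move/pcharf0P: k_char0 => ->; rewrite fT_card -lt0n prime_gt0 //.
move=> D.
pose E := double_basis (k := k) theta.
pose Ec := double_coord (k := k) theta.
have bmD : is_bismash D (double_rr theta) (double_ll theta) E.
  exact: double_bismash fC thetaM actE.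
have cE o c o' c' : Ec o c (E o' c') = ((o' == o) && (c' == c))%:R.
  exact: double_coordE.
have RE : drinfeld_double_R (smash_hopf k act) = doubleR theta E.
  exact: double_RE thetaM.
have chiE : chi = \sum_f beta f x *: dbas (theta x) f.
  apply: dual_eq => g f; rewrite {1}[f]LE (character_ebas actE _ _ _ chi_char).
  rewrite chi_x chi_e sum_lfunE (bigD1 f) //= scale_lfunE dbas_ebas eqxx andbT.
  rewrite big1 ?addr0 => [|n /negPf nN].
    rewrite thetax /beta (bichar_x LE x_q omega_q) [b == g]eq_sym.
    by rewrite [RHS]mulrC.
  by rewrite scale_lfunE dbas_ebas nN andbF; exact: mulr0.
move=> chix.
have -> : chix = central_elt beta E x.
  by rewrite /chix chiE; exact: tens_character.
move=> I K R.
have bmK := quot_is_bismash betaM betaC beta1 bmD cE F_gen.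
have KR : R = conjR theta beta (quot_basis beta D E x).
  have := quot_doubleR betaM betaC beta1 bmD cE F_gen.
  by rewrite /R RE.
split.
- split; first exact: bismash_is_hopf (conj_matched_pair thetaM) bmK.
  by have := quot_morphism betaM betaC beta1 bmD cE F_gen.
- rewrite KR; by have := conjR_quasitriangular fC thetaM betaM betaC beta1 bmK.
- rewrite KR.
  apply: (conj_factorizable betaM betaC beta1 orth fT0 bmK).
  by have := quot_coordE betaM betaC beta1 bmD cE F_gen; apply.
- rewrite KR; by have := conj_ribbon fC thetaM betaM betaC beta1 bmK.
rewrite (dim_quot betaM betaC beta1 bmD cE F_gen) fT_card.
rewrite (card_group p_prime q_prime p_mod_q tq_mod_p t_mod_p G_pres
  G_gen a_p b_q a_b).
by rewrite (expnD q 2 1) expn1 -!mulnn; nia.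
Qed.
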